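(* Let $C$ be a quasi-sectorial contraction on a Hilbert space $\mathfrak{H}$ with numerical range $W(C)\subseteq D_\alpha$, $0\le\alpha<\pi/2$. Then $$\left\|C^n-e^{n(C-\mathbf{1})}\right\|\le\frac{L_\alpha}{n^{1/3}},\qquad n\in\mathbb{N},$$ where $L_\alpha=2K_\alpha+2$, $K_\alpha:=\min_{\alpha'\in(\alpha,\pi/2)}K_{\alpha,\alpha'}$, and $$K_{\alpha,\alpha'}:=\frac{2}{\cos\alpha'\,\sin(\alpha'-\alpha)}\left(\frac1\pi-\frac{1}{e\ln(\sin\alpha')}\right).$$
   Context: $\mathbf{1}$ is the identity operator, $\mathbb{N}=\{1,2,\dots\}$, and $W(C)=\{(u,Cu):u\in\mathfrak{H},\ \|u\|=1\}$ is the numerical range. For $\alpha\in[0,\pi/2)$, $$D_\alpha:=\{z\in\mathbb{C}:|z|\le\sin\alpha\}\cup\{z\in\mathbb{C}:|\arg(1-z)|\le\alpha\ \text{and}\ |z-1|\le\cos\alpha\}$$ (the point $z=1$ is included). A contraction $C$ (bounded operator with $\|C\|\le1$) on $\mathfrak{H}$ is called quasi-sectorial with semi-angle $\alpha\in[0,\pi/2)$ (with respect to the vertex at $z=1$) if $W(C)\subseteq D_\alpha$. *)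

(* Defs.v *)
From Stdlib Require Import Arith Reals.
From Coquelicot Require Import Coquelicot.
Open Scope R_scope.

(* A Hilbert space is a complete normed module over the complex numbers together
   with an inner product inducing its norm; the inner product is linear in its
   second argument.  Definiteness follows from that of the norm. *)
Record inner_product (H : NormedModule C_AbsRing) := InnerProduct {
  ip :> H -> H -> C;
  ip_plus_r : forall u v w : H, ip u (plus v w) = Cplus (ip u v) (ip u w);
  ip_scal_r : forall (u v : H) (a : C), ip u (scal a v) = Cmult a (ip u v);
  ip_conj : forall u v : H, ip v u = Cconj (ip u v);
  ip_norm : forall u : H, ip u u = RtoC (norm u ^ 2)
}.
Arguments ip {H} _ _ _.

(* The operator norm takes values in [Rbar], so that an inequality
   [Rbar_le (opnorm T) r] with [r] real includes boundedness of [T]. *)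
Definition opnorm {H : NormedModule C_AbsRing} (T : H -> H) : Rbar :=
  Lub_Rbar (fun r : R => exists u : H, norm u <= 1 /\ r = norm (T u)).

Definition op_pow {H : NormedModule C_AbsRing} (T : H -> H) (n : nat) : H -> H :=
  fun u => Nat.iter n T u.

(* Sum of the exponential series, evaluated at each vector: for a bounded
   operator the series converges absolutely in operator norm, hence at each
   vector, to the same operator. *)
Definition op_exp {H : CompleteNormedModule C_AbsRing} (T : H -> H) : H -> H :=
  fun u =>
    lim (filtermap
           (sum_n (fun k : nat => scal (RtoC (/ INR (fact k))) (op_pow T k u)))
           eventually).

Definition num_range {H : NormedModule C_AbsRing} (dot : inner_product H)
    (T : H -> H) (z : C) : Prop :=
  exists u : H, norm u = 1 /\ z = dot u (T u).

(* [theta] is the principal value of arg z; for z = 0 every [theta] in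
   (-PI, PI] qualifies, so that the vertex z = 1 belongs to [D_set alpha]. *)
Definition is_arg (z : C) (theta : R) : Prop :=
  - PI < theta <= PI /\ z = Cmult (RtoC (Cmod z)) (cos theta, sin theta).

Definition D_set (alpha : R) (z : C) : Prop :=
  Cmod z <= sin alpha \/
  ((exists theta : R,
      is_arg (Cminus (RtoC 1) z) theta /\ Rabs theta <= alpha) /\
   Cmod (Cminus z (RtoC 1)) <= cos alpha).

(* [is_linear] includes boundedness. *)
Definition contraction {H : NormedModule C_AbsRing} (T : H -> H) : Prop :=
  is_linear T /\ Rbar_le (opnorm T) 1.

Definition quasi_sectorial {H : NormedModule C_AbsRing} (dot : inner_product H)
    (alpha : R) (T : H -> H) : Prop :=
  contraction T /\ forall z : C, num_range dot T z -> D_set alpha z.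

Definition K2 (alpha alpha' : R) : R :=
  2 / (cos alpha' * sin (alpha' - alpha)) *
  (1 / PI - 1 / (exp 1 * ln (sin alpha'))).

Definition is_minimum (A : R -> Prop) (m : R) : Prop :=
  A m /\ forall x : R, A x -> m <= x.

Definition is_K (alpha : R) : R -> Prop :=
  is_minimum (fun x : R =>
    exists alpha' : R, alpha < alpha' < PI / 2 /\ x = K2 alpha alpha').

(* Main.v *)
Require Import Defs.
From Stdlib Require Import Arith Reals.
From Coquelicot Require Import Coquelicot.
From Stdlib Require Import Lia Lra Psatz List.
Open Scope R_scope.

(** Write [A = 1 - T], [s = sin alpha] and, for [l >= 1], [D = 1 - A / l]: one
    step of the Euler scheme for the semigroup [exp (- t A)].  Since [D ^ (l n)]
    converges to [exp (- n A)] as [l] grows, it is enough to compare [T ^ n] with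
    [D ^ (l n)] up to a factor that tends to 1.  Two decay estimates enter,
    one for each of the two operators.

    - The domain [D_alpha] lies in a disc that touches the unit circle from
      inside at 1 only.  Hence [Re (|u|^2 - conj w (u, T u))] is at least
      [(1 - s) / 4 * |1 - w|^2 |u|^2] for [|w| = 1].  With [u] the discrete
      Fourier transform at [w] of an orbit of [T], the left-hand side averages
      over the roots of unity [w] to at most [2 |x|^2], and the right-hand side,
      by Parseval's identity, to a sum of squares of increments of the orbit.
      This gives the square function bound [square_function] and, as [T] is a
      contraction, [|T^j A| = O (1 / sqrt (j + 1))] ([power_decay]).

    - The domain [D_alpha] lies in the sector [|arg (1 - z)| <= alpha].  So the
      Euler step remains almost contractive when its length is given a complex
      factor [1 + w cos alpha] with [|w| = 1], and Cauchy's estimate for the coefficient of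
      [w] in the power of such a step gives
      [|A D^(l k)| <= exp (8 k / l) / (k cos alpha)] ([euler_analytic]).

    The telescoping sum of the [T^(n - 1 - k) (T - D^l) D^(l k)], in which
    [T - D^l] is [A^2 / 2] up to contractions ([euler_consistency]), is therefore
    at most the convolution of [1 / sqrt k] with [1 / k], of order
    [ln n / sqrt n] ([power_euler_distance]).  This is below [n^(-1/3)] for large
    [n].  It remains to see that [L = 2 K + 2] dominates the constants: if
    [n <= 64] then [L / n^(1/3)] exceeds the trivial bound 2, and for the other
    [n] it suffices to bound [K2 alpha alpha'] from below, uniformly in [alpha']
    ([K2_constant]).  The bound holds for every [alpha'], in particular for one
    that minimizes [K2 alpha], which exists because that function is continuous and
    tends to infinity at both ends of its interval ([K2_min_exists]). *)

(** * Linear identities in a complex vector space *)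

(** Syntax of linear combinations, for a reflexive decision procedure: a
    module identity holds as soon as the coefficient of every vector agrees on
    both sides. *)
Inductive vexpr : Type :=
| VVar : nat -> vexpr
| VZero : vexpr
| VPlus : vexpr -> vexpr -> vexpr
| VOpp : vexpr -> vexpr
| VScal : C -> vexpr -> vexpr.

Fixpoint vden {V : NormedModule C_AbsRing} (env : list V) (e : vexpr) : V :=
  match e with
  | VVar i => nth i env zero
  | VZero => zero
  | VPlus a b => plus (vden env a) (vden env b)
  | VOpp a => opp (vden env a)
  | VScal c a => scal c (vden env a)
  end.

Fixpoint vcoef (e : vexpr) (i : nat) : C :=
  match e with
  | VVar j => if Nat.eqb i j then RtoC 1 else RtoC 0
  | VZero => RtoC 0
  | VPlus a b => Cplus (vcoef a i) (vcoef b i)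
  | VOpp a => Copp (vcoef a i)
  | VScal c a => Cmult c (vcoef a i)
  end.

Fixpoint vlin {V : NormedModule C_AbsRing} (env : list V) (c : nat -> C) : V :=
  match env with
  | nil => zero
  | v :: l => plus (scal (c 0%nat) v) (vlin l (fun i => c (S i)))
  end.

Lemma vlin_ext {V : NormedModule C_AbsRing} (env : list V) (c d : nat -> C) :
  (forall i, c i = d i) -> vlin env c = vlin env d.
Proof.
  revert c d; induction env as [|v l IH]; intros c d E; simpl; [reflexivity|].
  rewrite (E 0%nat); f_equal; apply IH; intro i; apply E.
Qed.

Lemma scal_C0 {V : NormedModule C_AbsRing} (v : V) : scal (RtoC 0) v = zero.
Proof. exact (scal_zero_l v). Qed.

Lemma scal_C1 {V : NormedModule C_AbsRing} (v : V) : scal (RtoC 1) v = v.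
Proof. exact (scal_one v). Qed.

Lemma scal_Cplus {V : NormedModule C_AbsRing} (a b : C) (v : V) :
  scal (Cplus a b) v = plus (scal a v) (scal b v).
Proof. exact (scal_distr_r a b v). Qed.

Lemma scal_Cmult {V : NormedModule C_AbsRing} (a b : C) (v : V) :
  scal (Cmult a b) v = scal a (scal b v).
Proof. symmetry; exact (scal_assoc a b v). Qed.

Lemma vlin_zero {V : NormedModule C_AbsRing} (env : list V) :
  vlin env (fun _ => RtoC 0) = zero.
Proof.
  induction env as [|v l IH]; simpl; [reflexivity|].
  rewrite IH, plus_zero_r; apply scal_C0.
Qed.

Lemma vlin_plus {V : NormedModule C_AbsRing} (env : list V) (c d : nat -> C) :
  vlin env (fun i => Cplus (c i) (d i)) = plus (vlin env c) (vlin env d).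
Proof.
  revert c d; induction env as [|v l IH]; intros c d; simpl.
  - now rewrite plus_zero_l.
  - rewrite (IH (fun i => c (S i)) (fun i => d (S i))).
    rewrite scal_Cplus.
    rewrite <- !plus_assoc; f_equal.
    rewrite !plus_assoc; f_equal; apply plus_comm.
Qed.

Lemma vlin_scal {V : NormedModule C_AbsRing} (env : list V) (a : C) (c : nat -> C) :
  vlin env (fun i => Cmult a (c i)) = scal a (vlin env c).
Proof.
  revert c; induction env as [|v l IH]; intros c; simpl.
  - symmetry; exact (@scal_zero_r C_AbsRing V a).
  - rewrite (IH (fun i => c (S i))), scal_Cmult; symmetry; exact (scal_distr_l a _ _).
Qed.

Lemma vlin_var {V : NormedModule C_AbsRing} (env : list V) (j : nat) :
  vlin env (fun i => if Nat.eqb i j then RtoC 1 else RtoC 0) = nth j env zero.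
Proof.
  revert j; induction env as [|v l IH]; intros [|j]; simpl; try reflexivity.
  - rewrite (vlin_zero l), plus_zero_r; apply scal_C1.
  - rewrite (IH j), scal_C0; apply plus_zero_l.
Qed.

Lemma vden_vlin {V : NormedModule C_AbsRing} (env : list V) (e : vexpr) :
  vden env e = vlin env (vcoef e).
Proof.
  induction e as [j| |a IHa b IHb|a IHa|c a IHa]; simpl.
  - symmetry; apply vlin_var.
  - symmetry; apply vlin_zero.
  - now rewrite vlin_plus, IHa, IHb.
  - rewrite IHa.
    transitivity (scal (Copp (RtoC 1)) (vlin env (vcoef a))).
    + symmetry; exact (scal_opp_one (vlin env (vcoef a))).
    + rewrite <- vlin_scal; apply vlin_ext; intro i; ring.
  - now rewrite vlin_scal, IHa.
Qed.

Lemma vlin_cons {V : NormedModule C_AbsRing} (v : V) (l : list V) (c d : nat -> C) :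
  c 0%nat = d 0%nat ->
  vlin l (fun i => c (S i)) = vlin l (fun i => d (S i)) ->
  vlin (v :: l) c = vlin (v :: l) d.
Proof. simpl; intros -> ->; reflexivity. Qed.

Ltac v_mem x l :=
  match l with
  | nil => constr:(false)
  | x :: _ => constr:(true)
  | _ :: ?l' => v_mem x l'
  end.
Ltac v_idx x l :=
  match l with
  | x :: _ => constr:(0%nat)
  | _ :: ?l' => let i := v_idx x l' in constr:(S i)
  end.
Ltac v_env t l :=
  lazymatch t with
  | plus ?a ?b => let l1 := v_env a l in v_env b l1
  | minus ?a ?b => let l1 := v_env a l in v_env b l1
  | opp ?a => v_env a l
  | scal _ ?a => v_env a l
  | zero => l
  | _ => match v_mem t l with true => l | false => constr:(t :: l) end
  end.
Ltac v_reify t l :=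
  lazymatch t with
  | plus ?a ?b => let x := v_reify a l in let y := v_reify b l in constr:(VPlus x y)
  | minus ?a ?b =>
      let x := v_reify a l in let y := v_reify b l in constr:(VPlus x (VOpp y))
  | opp ?a => let x := v_reify a l in constr:(VOpp x)
  | scal ?c ?a => let x := v_reify a l in constr:(VScal c x)
  | zero => constr:(VZero)
  | _ => let i := v_idx t l in constr:(VVar i)
  end.

(** Reduces an equation between linear combinations of vectors to the
    equations between the coefficients of each vector. *)
Ltac vec_coefs :=
  match goal with
  | |- @eq ?U ?a ?b =>
      let l1 := v_env a (@nil U) in
      let l := v_env b l1 in
      let e1 := v_reify a l in
      let e2 := v_reify b l in
      change (vden l e1 = vden l e2);
      rewrite (vden_vlin l e1), (vden_vlin l e2);
      repeat (apply vlin_cons; [cbn [vcoef Nat.eqb]|]); [..|reflexivity]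
  end.
Ltac vec := vec_coefs; ring.

(** * Finite sums *)

(** The sum of the first [n] terms; unlike [sum_n] it includes the empty
    sum, on which the inductions on the length of an orbit start. *)
Fixpoint bsum {G : AbelianMonoid} (f : nat -> G) (n : nat) : G :=
  match n with
  | O => zero
  | S m => plus (bsum f m) (f m)
  end.

Lemma bsum_ext {G : AbelianMonoid} (f g : nat -> G) (n : nat) :
  (forall i, (i < n)%nat -> f i = g i) -> bsum f n = bsum g n.
Proof.
  induction n as [|n IH]; intros E; simpl; [reflexivity|].
  rewrite IH, E; auto.
Qed.

Lemma bsum_zero {G : AbelianMonoid} (n : nat) :
  bsum (fun _ => @zero G) n = zero.
Proof. induction n as [|n IH]; simpl; rewrite ?IH, ?plus_zero_l; reflexivity. Qed.

Lemma bsum_plus {G : AbelianMonoid} (f g : nat -> G) (n : nat) :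
  bsum (fun i => plus (f i) (g i)) n = plus (bsum f n) (bsum g n).
Proof.
  induction n as [|n IH]; simpl; [now rewrite plus_zero_l|].
  rewrite IH, <- !plus_assoc; f_equal.
  rewrite !plus_assoc; f_equal; apply plus_comm.
Qed.

Lemma bsum_morph {G K : AbelianMonoid} (phi : G -> K) (f : nat -> G) (n : nat) :
  phi zero = zero -> (forall x y, phi (plus x y) = plus (phi x) (phi y)) ->
  phi (bsum f n) = bsum (fun i => phi (f i)) n.
Proof.
  intros E0 EP; induction n as [|n IH]; simpl; [exact E0|].
  now rewrite EP, IH.
Qed.

Lemma bsum_switch {G : AbelianMonoid} (f : nat -> nat -> G) (n m : nat) :
  bsum (fun i => bsum (f i) m) n = bsum (fun j => bsum (fun i => f i j) n) m.
Proof.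
  induction n as [|n IH]; simpl.
  - now rewrite bsum_zero.
  - now rewrite IH, bsum_plus.
Qed.

Lemma bsum_S_l {G : AbelianMonoid} (f : nat -> G) (n : nat) :
  bsum f (S n) = plus (f 0%nat) (bsum (fun i => f (S i)) n).
Proof.
  induction n as [|n IH].
  - simpl; now rewrite plus_zero_l, plus_zero_r.
  - change (plus (bsum f (S n)) (f (S n)) =
            plus (f 0%nat) (plus (bsum (fun i => f (S i)) n) (f (S n)))).
    now rewrite IH, plus_assoc.
Qed.

Lemma bsum_single {G : AbelianMonoid} (f : nat -> G) (n j : nat) :
  (j < n)%nat -> (forall i, (i < n)%nat -> i <> j -> f i = zero) ->
  bsum f n = f j.
Proof.
  induction n as [|n IH]; intros Hj E; [lia|simpl].
  destruct (Nat.eq_dec j n) as [->|D].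
  - rewrite (bsum_ext f (fun _ => zero)) by (intros i Hi; apply E; lia).
    now rewrite bsum_zero, plus_zero_l.
  - rewrite IH by (intros; try apply E; lia).
    rewrite (E n) by lia; apply plus_zero_r.
Qed.

Lemma bsum_le (f g : nat -> R) (n : nat) :
  (forall i, (i < n)%nat -> f i <= g i) -> bsum f n <= bsum g n.
Proof.
  induction n as [|n IH]; intros E; simpl; [lra|].
  apply Rplus_le_compat; auto.
Qed.

Lemma bsum_Rscal (c : R) (f : nat -> R) (n : nat) :
  bsum (fun i => c * f i) n = c * bsum f n.
Proof.
  symmetry; apply (bsum_morph (fun x : R => c * x)).
  - apply Rmult_0_r.
  - intros x y; apply Rmult_plus_distr_l.
Qed.

Lemma bsum_Rconst (c : R) (n : nat) : bsum (fun _ => c) n = INR n * c.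
Proof.
  induction n as [|n IH]; [simpl; unfold zero; simpl; ring|].
  rewrite S_INR; simpl; rewrite IH; unfold plus; simpl; ring.
Qed.

Lemma norm_bsum {H : NormedModule C_AbsRing} (f : nat -> H) (n : nat) :
  norm (bsum f n) <= bsum (fun i => norm (f i)) n.
Proof.
  induction n as [|n IH]; simpl.
  - rewrite norm_zero; apply Rle_refl.
  - eapply Rle_trans; [apply norm_triangle|].
    apply Rplus_le_compat_r, IH.
Qed.

Lemma bsum_Cscal_l (v : nat -> C) (n : nat) (c : C) :
  bsum (fun i => Cmult c (v i)) n = Cmult c (bsum v n).
Proof.
  symmetry; apply (bsum_morph (fun x : C => Cmult c x)).
  - apply Cmult_0_r.
  - intros x y; apply Cmult_plus_distr_l.
Qed.

Lemma bsum_Vscal_r {H : NormedModule C_AbsRing} (c : nat -> C) (v : H) (n : nat) :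
  bsum (fun i => scal (c i) v) n = scal (bsum c n) v.
Proof.
  symmetry; apply (bsum_morph (fun x : C => scal x v)).
  - apply scal_C0.
  - intros x y; apply scal_Cplus.
Qed.

(** * Roots of unity *)

(** [ring] after an equality in the additive monoid of [C] is retyped in [C]. *)
Ltac Cring := match goal with |- @eq _ ?a ?b => change (@eq C a b); ring end.

Definition cis (t : R) : C := (cos t, sin t).

Lemma cis_plus (a b : R) : cis (a + b) = Cmult (cis a) (cis b).
Proof. unfold cis; rewrite cos_plus, sin_plus; apply injective_projections; simpl; ring. Qed.

Lemma cis_pow (t : R) (n : nat) : Cpow (cis t) n = cis (INR n * t).
Proof.
  induction n as [|n IH].
  - simpl; rewrite Rmult_0_l; unfold cis; now rewrite cos_0, sin_0.
  - rewrite Cpow_S, IH, <- cis_plus, S_INR; f_equal; ring.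
Qed.

Lemma cis_conj (t : R) : Cconj (cis t) = cis (- t).
Proof. unfold cis, Cconj; simpl; now rewrite cos_neg, sin_neg. Qed.

Lemma cis_conj_mult (t : R) : Cmult (cis t) (Cconj (cis t)) = RtoC 1.
Proof.
  rewrite cis_conj, <- cis_plus, Rplus_opp_r; unfold cis; now rewrite cos_0, sin_0.
Qed.

Lemma Cmod_cis (t : R) : Cmod (cis t) = 1.
Proof.
  unfold Cmod, cis; simpl.
  replace (cos t * (cos t * 1) + sin t * (sin t * 1)) with 1; [apply sqrt_1|].
  pose proof (sin2_cos2 t) as E; unfold Rsqr in E; lra.
Qed.

Definition root (N k : nat) : C := cis (2 * PI * INR k / INR N).

Lemma root_conj_mult (N k : nat) :
  Cmult (root N k) (Cconj (root N k)) = RtoC 1.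
Proof. apply cis_conj_mult. Qed.

Lemma cis_2PI (q : nat) : cis (2 * PI * INR q) = RtoC 1.
Proof.
  replace (2 * PI * INR q) with (0 + 2 * INR q * PI) by ring.
  unfold cis; rewrite cos_period, sin_period, cos_0, sin_0; reflexivity.
Qed.

Lemma root_pow_N (N k : nat) : (0 < N)%nat -> Cpow (root N k) N = RtoC 1.
Proof.
  intros HN; unfold root; rewrite cis_pow.
  rewrite <- (cis_2PI k); f_equal; field.
  apply not_0_INR; lia.
Qed.

Lemma Cmult_integral_r (a b : C) : a <> RtoC 0 -> Cmult a b = RtoC 0 -> b = RtoC 0.
Proof.
  intros Ha E.
  replace b with (Cmult (Cinv a) (Cmult a b)) by (field; exact Ha).
  rewrite E; ring.
Qed.

(** A geometric sum whose ratio is a root of unity other than 1; the ratio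
    differs from 1 because [cos (2 t) = 1 - 2 (sin t)^2] with [0 < t < PI]. *)
Lemma root_sum (N q : nat) :
  (0 < q < N)%nat -> bsum (fun k => Cpow (root N k) q) N = RtoC 0.
Proof.
  intros [Hq HN].
  assert (HNR : 0 < INR N) by (apply lt_0_INR; lia).
  set (z := root N q).
  assert (E : forall k, Cpow (root N k) q = Cpow z k).
  { intro k; unfold z, root; rewrite !cis_pow; f_equal; field; lra. }
  rewrite (bsum_ext _ (fun k => Cpow z k)) by auto.
  assert (G : forall m, Cmult (Cminus z (RtoC 1)) (bsum (fun k => Cpow z k) m) =
                        Cminus (Cpow z m) (RtoC 1)).
  { induction m as [|m IH].
    { change (Cmult (Cminus z (RtoC 1)) (RtoC 0) = Cminus (RtoC 1) (RtoC 1)); ring. }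
    change (bsum (fun k => Cpow z k) (S m)) with
      (Cplus (bsum (fun k => Cpow z k) m) (Cpow z m)).
    rewrite Cmult_plus_distr_l, IH, Cpow_S; ring. }
  assert (Hz : Cminus z (RtoC 1) <> RtoC 0).
  { intro F.
    assert (F1 : cos (2 * (PI * INR q / INR N)) = 1).
    { apply (f_equal fst) in F; unfold z, root, cis in F; simpl in F.
      replace (2 * (PI * INR q / INR N)) with (2 * PI * INR q / INR N)
        by (field; lra); lra. }
    rewrite cos_2a_sin in F1.
    assert (0 < sin (PI * INR q / INR N)).
    { assert (0 < INR q / INR N < 1).
      { assert (0 < INR q) by (apply lt_0_INR; lia).
        assert (INR q < INR N) by (apply lt_INR; lia).
        split; [apply Rdiv_lt_0_compat; lra|].
        apply (Rmult_lt_reg_r (INR N)); [lra|].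
        unfold Rdiv; rewrite Rmult_assoc, Rinv_l; lra. }
      pose proof PI_RGT_0.
      replace (PI * INR q / INR N) with (PI * (INR q / INR N)) by (field; lra).
      apply sin_gt_0; nra. }
    nra. }
  pose proof (G N) as GN.
  unfold z in GN; rewrite root_pow_N in GN by lia; fold z in GN.
  apply (Cmult_integral_r _ _ Hz); rewrite GN; ring.
Qed.

Lemma root_orth (N i j : nat) :
  (i < N)%nat -> (j < N)%nat ->
  bsum (fun k => Cmult (Cpow (root N k) i) (Cpow (Cconj (root N k)) j)) N =
  if Nat.eqb i j then RtoC (INR N) else RtoC 0.
Proof.
  assert (one_pow : forall k m, Cmult (Cpow (root N k) m) (Cpow (Cconj (root N k)) m)
            = RtoC 1).
  { intros k m; rewrite <- Cpow_mult_l, root_conj_mult; apply Cpow_1_l. }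
  assert (up : forall i j, (j < i)%nat -> (i < N)%nat ->
    bsum (fun k => Cmult (Cpow (root N k) i) (Cpow (Cconj (root N k)) j)) N
      = RtoC 0).
  { intros a b Hab Ha.
    rewrite <- (root_sum N (a - b)) by lia.
    apply bsum_ext; intros k _.
    replace a with ((a - b) + b)%nat at 1 by lia.
    rewrite Cpow_add_r, <- Cmult_assoc, one_pow; Cring. }
  intros Hi Hj.
  destruct (Nat.eqb_spec i j) as [->|D].
  - rewrite (bsum_ext _ (fun _ => RtoC 1)) by (intros; apply one_pow).
    clear; induction N as [|N IH]; [reflexivity|].
    rewrite S_INR, RtoC_plus; simpl; rewrite IH; reflexivity.
  - destruct (Nat.lt_ge_cases j i) as [L|L]; [apply up; lia|].
    transitivity (Cconj (RtoC 0)); [|unfold Cconj, RtoC; simpl; f_equal; ring].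
    rewrite <- (up j i) by lia.
    rewrite (bsum_morph Cconj).
    + apply bsum_ext; intros k _.
      rewrite Cmult_conj, !Cpow_conj, Cconj_conj; Cring.
    + unfold Cconj, zero; simpl; unfold RtoC; f_equal; ring.
    + intros x y; apply Cplus_conj.
Qed.

(** * The inner product and Parseval's identity *)

Lemma ip_plus_l {H : NormedModule C_AbsRing} (dot : inner_product H) (u v w : H) :
  dot (plus u v) w = Cplus (dot u w) (dot v w).
Proof.
  rewrite (ip_conj _ dot w (plus u v)), (ip_conj _ dot w u), (ip_conj _ dot w v).
  rewrite (ip_plus_r _ dot); apply Cplus_conj.
Qed.

Lemma ip_scal_l {H : NormedModule C_AbsRing} (dot : inner_product H) (u v : H) (a : C) :
  dot (scal a u) v = Cmult (Cconj a) (dot u v).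
Proof.
  rewrite (ip_conj _ dot v (scal a u)), (ip_conj _ dot v u).
  rewrite (ip_scal_r _ dot); apply Cmult_conj.
Qed.

Lemma ip_zero_r {H : NormedModule C_AbsRing} (dot : inner_product H) (u : H) :
  dot u zero = RtoC 0.
Proof.
  transitivity (dot u (scal (RtoC 0) u)); [now rewrite scal_C0|].
  rewrite (ip_scal_r _ dot); ring.
Qed.

Lemma ip_zero_l {H : NormedModule C_AbsRing} (dot : inner_product H) (u : H) :
  dot zero u = RtoC 0.
Proof.
  transitivity (dot (scal (RtoC 0) u) u); [now rewrite scal_C0|].
  rewrite ip_scal_l; apply injective_projections; simpl; ring.
Qed.

Lemma ip_opp_r {H : NormedModule C_AbsRing} (dot : inner_product H) (u v : H) :
  dot u (opp v) = Copp (dot u v).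
Proof.
  replace (opp v) with (scal (Copp (RtoC 1)) v) by vec.
  rewrite (ip_scal_r _ dot); ring.
Qed.

Lemma ip_minus_r {H : NormedModule C_AbsRing} (dot : inner_product H) (u v w : H) :
  dot u (minus v w) = Cminus (dot u v) (dot u w).
Proof. unfold minus; now rewrite (ip_plus_r _ dot), ip_opp_r. Qed.

Lemma norm_sqr {H : NormedModule C_AbsRing} (dot : inner_product H) (u : H) :
  norm u ^ 2 = Re (dot u u).
Proof. rewrite (ip_norm _ dot); reflexivity. Qed.

Lemma norm_plus_sqr {H : NormedModule C_AbsRing} (dot : inner_product H) (u v : H) :
  norm (plus u v) ^ 2 = norm u ^ 2 + 2 * Re (dot u v) + norm v ^ 2.
Proof.
  rewrite !(norm_sqr dot), (ip_plus_r _ dot), !ip_plus_l.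
  rewrite (ip_conj _ dot u v); unfold Re, Cconj; simpl; ring.
Qed.

Lemma norm_minus_sqr {H : NormedModule C_AbsRing} (dot : inner_product H) (u v : H) :
  norm (minus u v) ^ 2 = norm u ^ 2 - 2 * Re (dot u v) + norm v ^ 2.
Proof.
  unfold minus; rewrite (norm_plus_sqr dot), ip_opp_r, norm_opp.
  unfold Re, Copp; simpl; ring.
Qed.

Lemma norm_scal_sqr {H : NormedModule C_AbsRing} (dot : inner_product H) (a : C) (u : H) :
  norm (scal a u) ^ 2 = (fst a ^ 2 + snd a ^ 2) * norm u ^ 2.
Proof.
  rewrite (norm_sqr dot), (ip_scal_r _ dot), ip_scal_l, (ip_norm _ dot).
  unfold Re; simpl; ring.
Qed.

Lemma norm_scal_Cmod {H : NormedModule C_AbsRing} (a : C) (u : H) :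
  norm (scal a u) <= Cmod a * norm u.
Proof. exact (norm_scal a u). Qed.

Lemma ip_bsum_r {H : NormedModule C_AbsRing} (dot : inner_product H) (u : H)
    (f : nat -> H) (n : nat) :
  dot u (bsum f n) = bsum (fun i => dot u (f i)) n.
Proof. apply (bsum_morph (dot u)); [apply ip_zero_r|intros; apply ip_plus_r]. Qed.

Lemma ip_bsum_l {H : NormedModule C_AbsRing} (dot : inner_product H) (u : H)
    (f : nat -> H) (n : nat) :
  dot (bsum f n) u = bsum (fun i => dot (f i) u) n.
Proof.
  apply (bsum_morph (fun v => dot v u)); [apply ip_zero_l|].
  intros; apply ip_plus_l.
Qed.

Definition dft {H : NormedModule C_AbsRing} (N : nat) (a : nat -> H) (k : nat) : H :=
  bsum (fun i => scal (Cpow (Cconj (root N k)) i) (a i)) N.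

Lemma Re_bsum (f : nat -> C) (n : nat) : Re (bsum f n) = bsum (fun i => Re (f i)) n.
Proof. apply (bsum_morph (Re : C_AbelianMonoid -> R_AbelianMonoid)); reflexivity. Qed.

Lemma dft_parseval {H : NormedModule C_AbsRing} (dot : inner_product H) (N : nat)
    (a : nat -> H) :
  bsum (fun k => norm (dft N a k) ^ 2) N = INR N * bsum (fun i => norm (a i) ^ 2) N.
Proof.
  assert (E : bsum (fun k => dot (dft N a k) (dft N a k)) N =
              bsum (fun i => Cmult (RtoC (INR N)) (dot (a i) (a i))) N).
  { rewrite (bsum_ext _ (fun k => bsum (fun i => bsum (fun j =>
      Cmult (dot (a i) (a j))
        (Cmult (Cpow (root N k) i) (Cpow (Cconj (root N k)) j))) N) N)).
    2: { intros k _; etransitivity; [apply (ip_bsum_l dot)|]; apply bsum_ext; intros i _.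
         etransitivity; [apply (ip_bsum_r dot)|]; apply bsum_ext; intros j _.
         rewrite (ip_scal_r _ dot), ip_scal_l, Cpow_conj, Cconj_conj; Cring. }
    rewrite bsum_switch; apply bsum_ext; intros i Hi.
    rewrite bsum_switch.
    rewrite (bsum_single _ N i Hi).
    - rewrite bsum_Cscal_l, root_orth, Nat.eqb_refl by assumption; Cring.
    - intros j Hj D; rewrite bsum_Cscal_l, root_orth by assumption.
      destruct (Nat.eqb_spec i j) as [->|_]; [now elim D|apply Cmult_0_r]. }
  apply (f_equal Re) in E.
  rewrite !Re_bsum in E.
  rewrite <- bsum_Rscal.
  etransitivity; [|etransitivity; [exact E|]]; apply bsum_ext; intros i _.
  - apply norm_sqr.
  - rewrite (ip_norm _ dot); unfold Re; simpl; ring.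
Qed.

(** Inversion at time 0. *)
Lemma dft_sum {H : NormedModule C_AbsRing} (N : nat) (a : nat -> H) :
  (0 < N)%nat -> bsum (dft N a) N = scal (RtoC (INR N)) (a 0%nat).
Proof.
  intros HN; unfold dft; rewrite bsum_switch.
  rewrite (bsum_ext _ (fun j => scal (bsum (fun k => 
     Cmult (Cpow (root N k) 0) (Cpow (Cconj (root N k)) j)) N) (a j))).
  2: { intros j _; etransitivity; [apply bsum_Vscal_r|].
       f_equal; apply bsum_ext; intros; simpl; Cring. }
  rewrite (bsum_single _ N 0 HN).
  - rewrite root_orth by lia; reflexivity.
  - intros j Hj D; rewrite root_orth by lia.
    destruct j; [now elim D|apply scal_C0].
Qed.

(** * Linear maps and their iterates *)

(** Linearity alone; bounds are stated separately, with their constants. *)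
Definition Clinear {H : NormedModule C_AbsRing} (L : H -> H) : Prop :=
  (forall x y, L (plus x y) = plus (L x) (L y)) /\
  (forall (a : C) x, L (scal a x) = scal a (L x)).

Lemma Clinear_zero {H : NormedModule C_AbsRing} (L : H -> H) :
  Clinear L -> L zero = zero.
Proof.
  intros [_ S]; transitivity (L (scal (RtoC 0) zero)); [now rewrite scal_C0|].
  rewrite S; apply scal_C0.
Qed.

Lemma Clinear_minus {H : NormedModule C_AbsRing} (L : H -> H) (x y : H) :
  Clinear L -> L (minus x y) = minus (L x) (L y).
Proof.
  intros [P S].
  replace (minus x y) with (plus x (scal (Copp (RtoC 1)) y)) by vec.
  rewrite P, S; vec.
Qed.

Lemma Clinear_iter {H : NormedModule C_AbsRing} (L : H -> H) (n : nat) :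
  Clinear L -> Clinear (Nat.iter n L).
Proof.
  intros [P S]; induction n as [|n [IHP IHS]]; split; simpl; intros; auto.
  - now rewrite IHP, P.
  - now rewrite IHS, S.
Qed.

Lemma Clinear_bsum {H : NormedModule C_AbsRing} (L : H -> H) (f : nat -> H) (n : nat) :
  Clinear L -> L (bsum f n) = bsum (fun i => L (f i)) n.
Proof.
  intros LL; apply (bsum_morph L); [now apply Clinear_zero|apply LL].
Qed.

Definition nonexpansive {H : NormedModule C_AbsRing} (L : H -> H) : Prop :=
  forall x, norm (L x) <= norm x.

Lemma nonexpansive_iter {H : NormedModule C_AbsRing} (L : H -> H) (n : nat) :
  nonexpansive L -> nonexpansive (Nat.iter n L).
Proof.
  intros E; induction n as [|n IH]; intros x; simpl; [apply Rle_refl|].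
  eapply Rle_trans; [apply E|apply IH].
Qed.

Lemma iter_commute {X : Type} (f g : X -> X) (n : nat) (x : X) :
  (forall y, f (g y) = g (f y)) -> f (Nat.iter n g x) = Nat.iter n g (f x).
Proof. intros E; now apply Nat.iter_swap_gen. Qed.

(** * The domain D_alpha and the quadratic form of the operator *)

Lemma Rabs_sq_le (x y : R) : 0 <= y -> x ^ 2 <= y ^ 2 -> Rabs x <= y.
Proof. intros Hy E; apply Rabs_le; split; nra. Qed.

(** Cauchy-Schwarz in the plane. *)
Lemma cos_sin_le (x y t r : R) : 0 <= r -> x ^ 2 + y ^ 2 <= r ^ 2 ->
  cos t * x + sin t * y <= r.
Proof.
  intros Hr E; pose proof (sin2_cos2 t) as T; unfold Rsqr in T.
  assert (0 <= (cos t * y - sin t * x) ^ 2) by apply pow2_ge_0.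
  apply Rle_trans with (Rabs (cos t * x + sin t * y)); [apply Rle_abs|].
  apply Rabs_sq_le; [exact Hr|].
  replace ((cos t * x + sin t * y) ^ 2) with
    ((sin t * sin t + cos t * cos t) * (x ^ 2 + y ^ 2) - (cos t * y - sin t * x) ^ 2)
    by ring.
  rewrite T; lra.
Qed.

Lemma Cmod_sqr (z : C) : Cmod z ^ 2 = fst z ^ 2 + snd z ^ 2.
Proof. unfold Cmod; apply pow2_sqrt; nra. Qed.

(** Polar coordinates at the vertex 1, so that the rest of the argument about
    [D_alpha] does not mention angles: [z = 1 - rho (c - i s)]. *)
Lemma D_set_cases (alpha : R) (z : C) : 0 <= alpha < PI / 2 -> D_set alpha z ->
  fst z ^ 2 + snd z ^ 2 <= sin alpha ^ 2 \/
  exists rho c s : R, z = (1 - rho * c, rho * s) /\ 0 <= rho <= cos alpha /\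
    cos alpha <= c /\ Rabs s <= sin alpha /\ c ^ 2 + s ^ 2 = 1.
Proof.
  intros Ha [D|[[th [[_ Ez] Hth]] Hc]].
  - left; rewrite <- Cmod_sqr.
    pose proof (Cmod_ge_0 z); apply pow_incr; lra.
  - right; exists (Cmod (Cminus (RtoC 1) z)), (cos th), (- sin th).
    assert (E : Cmod (Cminus z (RtoC 1)) = Cmod (Cminus (RtoC 1) z)).
    { rewrite <- Cmod_opp; f_equal; ring. }
    set (rho := Cmod (Cminus (RtoC 1) z)) in *.
    repeat split.
    + apply injective_projections; simpl.
      * apply (f_equal fst) in Ez; simpl in Ez; lra.
      * apply (f_equal snd) in Ez; simpl in Ez; lra.
    + apply Cmod_ge_0.
    + lra.
    + apply Rabs_le_between in Hth.
      assert (cos (Rabs th) = cos th) as <-.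
      { unfold Rabs; destruct (Rcase_abs th); [apply cos_neg|reflexivity]. }
      apply cos_decr_1; try lra; [apply Rabs_pos|apply Rabs_le; lra|
        apply Rabs_le; lra].
    + apply Rabs_le_between in Hth; rewrite Rabs_Ropp.
      apply Rabs_le; rewrite <- sin_neg; split; apply sin_incr_1; lra.
    + pose proof (sin2_cos2 th) as T; unfold Rsqr in T; lra.
Qed.

(** The lines bounding the sector are tangent to the disc of radius
    [sin alpha], so the disc lies in the sector too. *)
Lemma D_set_sector (alpha : R) (z : C) : 0 <= alpha < PI / 2 -> D_set alpha z ->
  Rabs (snd z) * cos alpha <= sin alpha * (1 - fst z).
Proof.
  intros Ha D.
  assert (Hc : 0 < cos alpha) by (apply cos_gt_0; lra).
  assert (Hs : 0 <= sin alpha) by (apply sin_ge_0; lra).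
  destruct (D_set_cases alpha z Ha D) as [E|(rho & c & s & -> & Hr & Hcc & Hss & _)].
  - pose proof (cos_sin_le (snd z) (fst z) alpha (sin alpha) Hs ltac:(lra)).
    pose proof (cos_sin_le (- snd z) (fst z) alpha (sin alpha) Hs ltac:(nra)).
    unfold Rabs; destruct (Rcase_abs (snd z)); lra.
  - simpl; rewrite Rabs_mult, (Rabs_right rho) by lra.
    pose proof (Rabs_pos s).
    replace (1 - (1 - rho * c)) with (rho * c) by ring.
    assert (Rabs s * cos alpha <= sin alpha * c) by nra.
    nra.
Qed.

(** The right-hand side is the support function of the disc that touches the
    unit circle from inside at 1 and has radius [(1 + sin alpha) / 2].  This disc
    contains the disc of radius [sin alpha] and the point 1, and every other
    point of [D_alpha] lies on a segment from 1 to a point of the smaller disc. *)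
Lemma D_set_disc (alpha t : R) (z : C) : 0 <= alpha < PI / 2 -> D_set alpha z ->
  cos t * fst z + sin t * snd z <= 1 - (1 - sin alpha) / 2 * (1 - cos t).
Proof.
  intros Ha D.
  assert (Hc : 0 < cos alpha) by (apply cos_gt_0; lra).
  assert (Hs : 0 <= sin alpha) by (apply sin_ge_0; lra).
  assert (Hs1 : sin alpha <= 1) by apply SIN_bound.
  pose proof (COS_bound t).
  assert (Disc : forall x y, x ^ 2 + y ^ 2 <= sin alpha ^ 2 ->
    cos t * x + sin t * y <= 1 - (1 - sin alpha) / 2 * (1 - cos t)).
  { intros x y E; pose proof (cos_sin_le x y t (sin alpha) Hs E); nra. }
  destruct (D_set_cases alpha z Ha D) as [E|(rho & c & s & -> & Hr & Hcc & Hss & E)].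
  - now apply Disc.
  - simpl.
    pose proof (sin2_cos2 alpha) as T; unfold Rsqr in T.
    assert (F : cos t * (1 - cos alpha * c) + sin t * (cos alpha * s) <=
                1 - (1 - sin alpha) / 2 * (1 - cos t)).
    { apply Disc.
      replace ((1 - cos alpha * c) ^ 2 + (cos alpha * s) ^ 2) with
        (1 - 2 * cos alpha * c + cos alpha ^ 2 * (c ^ 2 + s ^ 2)) by ring.
      rewrite E; nra. }
    (* on the ray from 1 through z, the point at distance cos alpha from 1 lies
       in the small disc *)
    set (tau := rho / cos alpha).
    assert (Ht : 0 <= tau <= 1).
    { unfold tau; split; [apply Rdiv_le_0_compat; lra|].
      apply (Rmult_le_reg_r (cos alpha)); [lra|]; unfold Rdiv.
      rewrite Rmult_assoc, Rinv_l; lra. }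
    assert (Er : rho = tau * cos alpha) by (unfold tau; field; lra).
    clearbody tau; subst rho.
    replace (cos t * (1 - tau * cos alpha * c) + sin t * (tau * cos alpha * s)) with
      ((1 - tau) * cos t +
       tau * (cos t * (1 - cos alpha * c) + sin t * (cos alpha * s))) by ring.
    assert (cos t <= 1 - (1 - sin alpha) / 2 * (1 - cos t)) by nra.
    nra.
Qed.

Lemma num_range_homogeneous {H : NormedModule C_AbsRing} (dot : inner_product H)
    (T : H -> H) (P : C -> Prop) (u : H) :
  Clinear T -> (forall z, num_range dot T z -> P z) ->
  norm u <> 0 -> exists z, P z /\ dot u (T u) = Cmult (RtoC (norm u ^ 2)) z.
Proof.
  intros [_ LS] W Hu.
  set (v := scal (RtoC (/ norm u)) u).
  exists (dot v (T v)); split.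
  - apply W; exists v; split; [|reflexivity].
    assert (E : norm v ^ 2 = 1).
    { unfold v; rewrite (norm_scal_sqr dot); simpl; field; exact Hu. }
    pose proof (norm_ge_0 v); nra.
  - unfold v; rewrite LS, (ip_scal_r _ dot), ip_scal_l.
    apply injective_projections; simpl; field; exact Hu.
Qed.

Lemma norm_eq_0_ip {H : NormedModule C_AbsRing} (dot : inner_product H) (u v : H) :
  norm u = 0 -> dot u v = RtoC 0.
Proof. intros E; apply norm_eq_zero in E; rewrite E; apply ip_zero_l. Qed.

Lemma quasi_sectorial_sector {H : NormedModule C_AbsRing} (dot : inner_product H)
    (alpha : R) (T : H -> H) (u : H) :
  0 <= alpha < PI / 2 -> Clinear T ->
  (forall z, num_range dot T z -> D_set alpha z) ->
  Rabs (snd (dot u (minus u (T u)))) * cos alpha <=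
  sin alpha * fst (dot u (minus u (T u))).
Proof.
  intros Ha LT W.
  destruct (Req_dec (norm u) 0) as [E|E].
  - rewrite !(norm_eq_0_ip dot _ _ E); simpl; rewrite Rabs_R0; lra.
  - destruct (num_range_homogeneous dot T _ u LT W E) as (z & Dz & Ez).
    unfold minus; rewrite (ip_plus_r _ dot), ip_opp_r, Ez, (ip_norm _ dot).
    pose proof (D_set_sector alpha z Ha Dz) as Q.
    replace (snd _) with (norm u ^ 2 * - snd z) by (simpl; ring).
    replace (fst _) with (norm u ^ 2 * (1 - fst z)) by (simpl; ring).
    pose proof (pow2_ge_0 (norm u)).
    rewrite Rabs_mult, Rabs_Ropp, (Rabs_right (norm u ^ 2)) by lra; nra.
Qed.

Lemma quasi_sectorial_disc {H : NormedModule C_AbsRing} (dot : inner_product H)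
    (alpha : R) (T : H -> H) (t : R) (u : H) :
  0 <= alpha < PI / 2 -> Clinear T ->
  (forall z, num_range dot T z -> D_set alpha z) ->
  cos t * fst (dot u (T u)) + sin t * snd (dot u (T u)) <=
  (1 - (1 - sin alpha) / 2 * (1 - cos t)) * norm u ^ 2.
Proof.
  intros Ha LT W.
  destruct (Req_dec (norm u) 0) as [E|E].
  - rewrite !(norm_eq_0_ip dot _ _ E), E; simpl; lra.
  - destruct (num_range_homogeneous dot T _ u LT W E) as (z & Dz & ->).
    pose proof (D_set_disc alpha t z Ha Dz) as Q.
    pose proof (pow2_ge_0 (norm u)); simpl; simpl in Q; nra.
Qed.

(** * Decay of the increments of an orbit *)

(** For [w ^ n = 1], the transform of an orbit is a resolvent of [T] applied to
    [x - T^n x]. *)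
Lemma geometric_sum {H : NormedModule C_AbsRing} (T : H -> H) (w : C) (x : H) (n : nat) :
  Clinear T ->
  let u : H := bsum (fun i => scal (Cpow w i) (Nat.iter i T x)) n in
  minus u (scal w (T u)) = minus x (scal (Cpow w n) (Nat.iter n T x)).
Proof.
  intros LT; pose proof LT as [P S]; induction n as [|n IH].
  - change (bsum _ 0) with (zero : H); cbv zeta.
    rewrite (Clinear_zero T LT); simpl; vec.
  - cbv zeta in *.
    set (u := bsum (fun i => scal (Cpow w i) (Nat.iter i T x)) n : H) in *.
    change (bsum _ (Datatypes.S n)) with (plus u (scal (Cpow w n) (Nat.iter n T x))).
    rewrite P, S, Cpow_S.
    change (Nat.iter (Datatypes.S n) T x) with (T (Nat.iter n T x)).
    transitivity (plus (minus u (scal w (T u)))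
      (minus (scal (Cpow w n) (Nat.iter n T x))
             (scal (Cmult w (Cpow w n)) (T (Nat.iter n T x))))); [vec|].
    rewrite IH; vec.
Qed.

(** The orbit is closed up cyclically: its zeroth increment leads from the last
    point back to [x], so that the Fourier transform turns the increments into a
    multiplication. *)
Definition orbit_diff {H : NormedModule C_AbsRing} (T : H -> H) (x : H) (n i : nat) : H :=
  match i with
  | O => minus x (Nat.iter (n - 1) T x)
  | S j => minus (Nat.iter (S j) T x) (Nat.iter j T x)
  end.

Lemma dft_orbit_diff {H : NormedModule C_AbsRing} (T : H -> H) (x : H) (n k : nat) :
  (0 < n)%nat ->
  dft n (orbit_diff T x n) k =
  scal (Cminus (RtoC 1) (Cconj (root n k))) (dft n (fun i => Nat.iter i T x) k).
Proof.
  intros Hn; unfold dft; set (w := Cconj (root n k)).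
  assert (Hw : Cpow w n = RtoC 1).
  { unfold w; rewrite <- Cpow_conj, root_pow_N by exact Hn.
    apply injective_projections; simpl; ring. }
  assert (E : forall m,
    bsum (fun i => scal (Cpow w i) (orbit_diff T x n i)) (S m) =
    minus (minus (scal (Cminus (RtoC 1) w)
        (bsum (fun i => scal (Cpow w i) (Nat.iter i T x)) (S m)))
        (Nat.iter (n - 1) T x))
      (opp (scal (Cpow w (S m)) (Nat.iter m T x)))).
  { induction m as [|m IH].
    - simpl; rewrite !scal_C1; vec.
    - change (bsum ?f (S (S m))) with (plus (bsum f (S m)) (f (S m))).
      rewrite IH; cbv beta; unfold orbit_diff at 1.
      set (u := bsum _ (S m)); rewrite !Cpow_S; simpl Nat.iter; vec. }
  destruct n as [|n]; [lia|].
  rewrite E, Hw; replace (S n - 1)%nat with n by lia; vec.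
Qed.

Lemma Re_ip_minus_le {H : NormedModule C_AbsRing} (dot : inner_product H) (x y : H) :
  norm y <= norm x -> Re (dot x (minus x y)) <= 2 * norm x ^ 2.
Proof.
  intros E; rewrite ip_minus_r, (ip_norm _ dot).
  pose proof (norm_plus_sqr dot x y) as Q.
  pose proof (pow2_ge_0 (norm (plus x y))).
  pose proof (norm_ge_0 y).
  assert (norm y ^ 2 <= norm x ^ 2) by (apply pow_incr; lra).
  unfold Re in *; simpl; simpl in *; lra.
Qed.

(** Averaging [Re (u, x - T^n x) >= delta (1 - cos t) |u|^2] over the roots of
    unity, with [u] the transform of the orbit of [x].  On the left, the average
    of [u] is [x]; on the right, [2 (1 - cos t) |u|^2] is the squared norm of the
    transform of the increments. *)
Lemma square_function {H : NormedModule C_AbsRing} (dot : inner_product H)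
    (T : H -> H) (delta : R) (x : H) (n : nat) :
  0 < delta -> Clinear T -> nonexpansive T -> (0 < n)%nat ->
  (forall t u, cos t * fst (dot u (T u)) + sin t * snd (dot u (T u)) <=
     (1 - delta * (1 - cos t)) * norm u ^ 2) ->
  bsum (fun i => norm (orbit_diff T x n i) ^ 2) n <= 4 / delta * norm x ^ 2.
Proof.
  intros Hd LT CT Hn W.
  set (a := fun i => Nat.iter i T x).
  assert (HNR : 0 < INR n) by (apply lt_0_INR; lia).
  assert (K : forall k, (k < n)%nat ->
    delta / 2 * norm (dft n (orbit_diff T x n) k) ^ 2 <=
    Re (dot (dft n a k) (minus x (Nat.iter n T x)))).
  { intros k _.
    rewrite dft_orbit_diff by exact Hn; fold a.
    rewrite (norm_scal_sqr dot).
    pose proof (geometric_sum T (Cconj (root n k)) x n LT) as G; cbv zeta in G.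
    fold a in G; change (bsum _ n) with (dft n a k) in G.
    rewrite <- Cpow_conj, root_pow_N in G by exact Hn.
    replace (scal (Cconj (RtoC 1)) (Nat.iter n T x)) with (Nat.iter n T x) in G.
    2: { replace (Cconj (RtoC 1)) with (RtoC 1); [symmetry; apply scal_C1|].
         apply injective_projections; simpl; ring. }
    rewrite <- G; set (u := dft n a k).
    rewrite ip_minus_r, (ip_scal_r _ dot).
    rewrite (ip_norm _ dot).
    unfold root; set (t := 2 * PI * INR k / INR n).
    pose proof (W t u) as Wu.
    pose proof (sin2_cos2 t) as T2; unfold Rsqr in T2.
    unfold Re; simpl; simpl in Wu.
    replace ((1 + - cos t) * ((1 + - cos t) * 1) + (0 + - - sin t) * ((0 + - - sin t) * 1))
      with (2 * (1 - cos t)) by (ring_simplify; lra).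
    lra. }
  apply bsum_le in K; rewrite bsum_Rscal in K.
  rewrite (dft_parseval dot) in K.
  assert (E : bsum (fun k => Re (dot (dft n a k) (minus x (Nat.iter n T x)))) n =
    INR n * Re (dot x (minus x (Nat.iter n T x)))).
  { rewrite <- Re_bsum, <- (ip_bsum_l dot), dft_sum, ip_scal_l by exact Hn.
    unfold a, Re; simpl; ring. }
  rewrite E in K.
  pose proof (Re_ip_minus_le dot x (Nat.iter n T x) (nonexpansive_iter T n CT x)) as B.
  set (S := bsum _ n) in *.
  set (r := Re _) in *.
  assert (delta / 2 * S <= r).
  { apply (Rmult_le_reg_l (INR n)); [exact HNR|]; lra. }
  apply (Rmult_le_reg_l (delta / 2)); [lra|].
  replace (delta / 2 * (4 / delta * norm x ^ 2)) with (2 * norm x ^ 2) by (field; lra).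
  lra.
Qed.

(** The increments of an orbit of a contraction decrease in norm, so each is at
    most the mean of the preceding ones, which [square_function] bounds. *)
Lemma power_decay {H : NormedModule C_AbsRing} (dot : inner_product H)
    (T : H -> H) (delta : R) (x : H) (j : nat) :
  0 < delta -> Clinear T -> nonexpansive T ->
  (forall t u, cos t * fst (dot u (T u)) + sin t * snd (dot u (T u)) <=
     (1 - delta * (1 - cos t)) * norm u ^ 2) ->
  norm (Nat.iter j T (minus x (T x))) <= 2 / sqrt (delta * INR (S j)) * norm x.
Proof.
  intros Hd LT CT W.
  set (y := minus x (T x)).
  (* j + 2 points of the orbit: j + 1 increments and the cyclic one *)
  pose proof (square_function dot T delta x (S (S j)) Hd LT CT ltac:(lia) W) as Q.
  rewrite bsum_S_l in Q.
  assert (L : INR (S j) * norm (Nat.iter j T y) ^ 2 <=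
    bsum (fun i => norm (orbit_diff T x (S (S j)) (S i)) ^ 2) (S j)).
  { rewrite <- bsum_Rconst; apply bsum_le; intros i Hi.
    replace (orbit_diff T x (S (S j)) (S i)) with (opp (Nat.iter i T y)).
    - rewrite norm_opp; apply pow_incr; split; [apply norm_ge_0|].
      replace j with ((j - i) + i)%nat by lia.
      rewrite Nat.iter_add; apply nonexpansive_iter, CT.
    - unfold y; rewrite Clinear_minus by (now apply Clinear_iter).
      rewrite <- Nat.iter_succ_r; unfold orbit_diff; vec. }
  assert (0 <= norm (orbit_diff T x (S (S j)) 0) ^ 2) by apply pow2_ge_0.
  assert (HJ : 0 < INR (S j)) by (apply lt_0_INR; lia).
  assert (HS : 0 < delta * INR (S j)) by nra.
  assert (Q2 : INR (S j) * norm (Nat.iter j T y) ^ 2 <= 4 / delta * norm x ^ 2).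
  { unfold plus in Q; simpl AbelianMonoid.sort in Q; simpl in Q; simpl in L; simpl in *; lra. }
  pose proof (norm_ge_0 (Nat.iter j T y)); pose proof (norm_ge_0 x).
  assert (Hq : 0 < sqrt (delta * INR (S j))) by now apply sqrt_lt_R0.
  assert (Eq : sqrt (delta * INR (S j)) ^ 2 = delta * INR (S j)) by (apply pow2_sqrt; lra).
  apply Rsqr_incr_0_var.
  2: { apply Rmult_le_pos; [|assumption]; apply Rdiv_le_0_compat; lra. }
  apply (Rmult_le_reg_l (delta * INR (S j))); [lra|].
  unfold Rsqr; rewrite <- Eq at 2.
  set (q := sqrt _) in *.
  replace (q ^ 2 * (2 / q * norm x * (2 / q * norm x))) with (delta * (4 / delta * norm x ^ 2))
    by (field; lra).
  nra.
Qed.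

(** * Analyticity of the Euler scheme *)

Lemma norm_scal_R {H : NormedModule C_AbsRing} (dot : inner_product H) (r : R) (u : H) :
  0 <= r -> norm (scal (RtoC r) u) = r * norm u.
Proof.
  intros Hr; pose proof (norm_scal_sqr dot (RtoC r) u) as E; simpl in E.
  pose proof (norm_ge_0 (scal (RtoC r) u)); pose proof (norm_ge_0 u).
  apply Rsqr_inj; [assumption|nra|]; unfold Rsqr; nra.
Qed.

Definition pencil {H : NormedModule C_AbsRing} (P Q : H -> H) (N k : nat) (y : H) : H :=
  plus (P y) (scal (root N k) (Q y)).

Lemma pencil_linear {H : NormedModule C_AbsRing} (P Q : H -> H) (N k : nat) :
  Clinear P -> Clinear Q -> Clinear (pencil P Q N k).
Proof.
  intros [PP PS] [QP QS]; split; intros; unfold pencil.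
  - rewrite PP, QP; vec.
  - rewrite PS, QS; vec.
Qed.

(** As a polynomial in [w], the vector [(P + w Q)^m y] has no negative powers.
    Coefficients are read off by averaging over the [N]-th roots of unity, which
    is exact as long as [N] exceeds the degree.  The coefficients of index
    [- q], 0 and 1 come by induction on [m]: splitting off one factor [P + w Q]
    relates each of them to itself and to the preceding one. *)
Lemma pencil_negative_coef {H : NormedModule C_AbsRing} (P Q : H -> H) (N m : nat) :
  Clinear P -> Clinear Q ->
  forall (q : nat) (y : H), (0 < q)%nat -> (q + m < N)%nat ->
  bsum (fun k => scal (Cpow (root N k) q) (Nat.iter m (pencil P Q N k) y)) N = zero.
Proof.
  intros LP LQ; induction m as [|m IH]; intros q y Hq HN.
  - simpl; etransitivity; [apply (bsum_Vscal_r (fun k => Cpow (root N k) q) y)|].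
    rewrite root_sum by lia; apply scal_C0.
  - transitivity (plus
      (bsum (fun k => scal (Cpow (root N k) q) (Nat.iter m (pencil P Q N k) (P y))) N)
      (bsum (fun k => scal (Cpow (root N k) (S q)) (Nat.iter m (pencil P Q N k) (Q y))) N)).
    + rewrite <- (bsum_plus (G := NormedModule.AbelianMonoid _ H)).
      apply bsum_ext; intros k _.
      destruct (Clinear_iter _ m (pencil_linear P Q N k LP LQ)) as [IP IS].
      rewrite Nat.iter_succ_r; unfold pencil at 2.
      rewrite IP, IS, Cpow_S; vec.
    + rewrite !IH by lia; apply plus_zero_l.
Qed.

Lemma pencil_coef_0 {H : NormedModule C_AbsRing} (P Q : H -> H) (N m : nat) (y : H) :
  Clinear P -> Clinear Q -> (m < N)%nat ->
  bsum (fun k => Nat.iter m (pencil P Q N k) y) N =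
  scal (RtoC (INR N)) (Nat.iter m P y).
Proof.
  intros LP LQ; revert y; induction m as [|m IH]; intros y HN.
  - simpl; clear; induction N as [|N IH].
    + simpl; symmetry; apply scal_C0.
    + rewrite S_INR, RtoC_plus, scal_Cplus, scal_C1, <- IH; reflexivity.
  - transitivity (plus
      (bsum (fun k => Nat.iter m (pencil P Q N k) (P y)) N)
      (bsum (fun k => scal (Cpow (root N k) 1) (Nat.iter m (pencil P Q N k) (Q y))) N)).
    + rewrite <- (bsum_plus (G := NormedModule.AbelianMonoid _ H)).
      apply bsum_ext; intros k _.
      destruct (Clinear_iter _ m (pencil_linear P Q N k LP LQ)) as [IP IS].
      rewrite Nat.iter_succ_r; unfold pencil at 2.
      rewrite IP, IS, Cpow_1_r; reflexivity.
    + rewrite pencil_negative_coef, plus_zero_r, IH, Nat.iter_succ_r by (auto; lia).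
      reflexivity.
Qed.

Lemma pencil_coef_1 {H : NormedModule C_AbsRing} (P Q : H -> H) (N m : nat) (y : H) :
  Clinear P -> Clinear Q -> (forall z, P (Q z) = Q (P z)) -> (m < N)%nat -> (1 < N)%nat ->
  bsum (fun k => scal (Cconj (root N k)) (Nat.iter m (pencil P Q N k) y)) N =
  scal (RtoC (INR N * INR m)) (Nat.iter (m - 1) P (Q y)).
Proof.
  intros LP LQ PQ HN HN1; revert y HN; induction m as [|m IH]; intros y HN.
  - simpl Nat.iter; rewrite Rmult_0_r, scal_C0.
    etransitivity; [apply (bsum_Vscal_r (fun k => Cconj (root N k)) y)|].
    pose proof (root_orth N 0 1 ltac:(lia) ltac:(lia)) as E; simpl Nat.eqb in E.
    rewrite (bsum_ext _ (fun k => Cconj (root N k))) in E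
      by (intros; rewrite Cpow_1_r; simpl; Cring).
    rewrite E; apply scal_C0.
  - transitivity (plus
      (bsum (fun k => scal (Cconj (root N k)) (Nat.iter m (pencil P Q N k) (P y))) N)
      (bsum (fun k => Nat.iter m (pencil P Q N k) (Q y)) N)).
    + rewrite <- (bsum_plus (G := NormedModule.AbelianMonoid _ H)).
      apply bsum_ext; intros k _.
      destruct (Clinear_iter _ m (pencil_linear P Q N k LP LQ)) as [IP IS].
      rewrite Nat.iter_succ_r; unfold pencil at 2.
      rewrite IP, IS.
      transitivity (plus (scal (Cconj (root N k)) (Nat.iter m (pencil P Q N k) (P y)))
        (scal (Cmult (root N k) (Cconj (root N k))) (Nat.iter m (pencil P Q N k) (Q y))));
        [vec|].
      rewrite root_conj_mult, scal_C1; reflexivity.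
    + rewrite IH, (pencil_coef_0 P Q N m (Q y)) by (auto; lia).
      replace (S m - 1)%nat with m by lia.
      destruct m as [|m].
      * simpl; rewrite Rmult_0_r, Rmult_1_r; vec.
      * replace (S m - 1)%nat with m by lia.
        rewrite <- PQ, <- Nat.iter_succ_r, (S_INR (S m)).
        rewrite Rmult_plus_distr_l, Rmult_1_r, RtoC_plus; vec.
Qed.

(** Cauchy's estimate for the linear coefficient [m P^(m-1) Q y] of
    [(P + w Q)^m y] on the circle [|w| = 1]. *)
Lemma pencil_cauchy {H : NormedModule C_AbsRing} (dot : inner_product H)
    (P Q : H -> H) (m : nat) (B : R) (y : H) :
  Clinear P -> Clinear Q -> (forall z, P (Q z) = Q (P z)) -> 0 <= B ->
  (forall N k z, norm (pencil P Q N k z) <= B * norm z) ->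
  INR m * norm (Nat.iter (m - 1) P (Q y)) <= B ^ m * norm y.
Proof.
  intros LP LQ PQ HB E.
  set (N := (m + 2)%nat).
  assert (HN : 0 < INR N) by (apply lt_0_INR; unfold N; lia).
  pose proof (pencil_coef_1 P Q N m y LP LQ PQ ltac:(unfold N; lia) ltac:(unfold N; lia)) as C.
  apply (f_equal norm) in C.
  rewrite (norm_scal_R dot) in C by (pose proof (pos_INR m); nra).
  assert (It : forall k j, norm (Nat.iter j (pencil P Q N k) y) <= B ^ j * norm y).
  { intros k j; induction j as [|j IH]; simpl; [lra|].
    eapply Rle_trans; [apply E|]. rewrite Rmult_assoc; now apply Rmult_le_compat_l. }
  pose proof (norm_bsum (fun k => scal (Cconj (root N k))
    (Nat.iter m (pencil P Q N k) y)) N) as T.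
  assert (T2 : bsum (fun k => norm (scal (Cconj (root N k))
    (Nat.iter m (pencil P Q N k) y))) N <= INR N * (B ^ m * norm y)).
  { rewrite <- bsum_Rconst; apply bsum_le; intros k _.
    eapply Rle_trans; [apply norm_scal_Cmod|].
    unfold root; rewrite Cmod_conj, Cmod_cis, Rmult_1_l; apply It. }
  apply (Rmult_le_reg_l (INR N)); [exact HN|].
  rewrite <- Rmult_assoc, <- C; eapply Rle_trans; [exact T|exact T2].
Qed.

(** Explicit Euler step of length [1 / l] for the equation [u' = T u - u]. *)
Definition euler_step {H : NormedModule C_AbsRing} (T : H -> H) (l : nat) (y : H) : H :=
  minus y (scal (RtoC (/ INR l)) (minus y (T y))).

Lemma euler_step_linear {H : NormedModule C_AbsRing} (T : H -> H) (l : nat) :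
  Clinear T -> Clinear (euler_step T l).
Proof.
  intros [P S]; split; intros; unfold euler_step; rewrite ?P, ?S; vec.
Qed.

Lemma defect_linear {H : NormedModule C_AbsRing} (T : H -> H) :
  Clinear T -> Clinear (fun y => minus y (T y)).
Proof. intros [P S]; split; intros; rewrite ?P, ?S; vec. Qed.

Lemma euler_step_nonexpansive {H : NormedModule C_AbsRing} (dot : inner_product H)
    (T : H -> H) (l : nat) :
  nonexpansive T -> (0 < l)%nat -> nonexpansive (euler_step T l).
Proof.
  intros CT Hl y.
  assert (1 <= INR l) by (apply (le_INR 1); lia).
  assert (0 <= / INR l <= 1).
  { split; [left; apply Rinv_0_lt_compat; lra|].
    rewrite <- Rinv_1; apply Rinv_le_contravar; lra. }
  replace (euler_step T l y) with
    (plus (scal (RtoC (1 - / INR l)) y) (scal (RtoC (/ INR l)) (T y)) : H).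
  2: { unfold euler_step; rewrite RtoC_minus; vec. }
  eapply Rle_trans;
    [exact (@norm_triangle C_AbsRing H (scal (RtoC (1 - / INR l)) y)
              (scal (RtoC (/ INR l)) (T y)))|].
  rewrite !(norm_scal_R dot) by lra.
  pose proof (CT y); nra.
Qed.

Lemma norm_defect {H : NormedModule C_AbsRing} (T : H -> H) (y : H) :
  nonexpansive T -> norm (minus y (T y)) <= 2 * norm y.
Proof.
  intros CT; unfold minus; eapply Rle_trans; [apply norm_triangle|].
  rewrite norm_opp; pose proof (CT y); lra.
Qed.

(** The pencil is the Euler step with complex length
    [zeta = (1 + w cos alpha) / l].  As [arg zeta] is at most [PI / 2 - alpha] in
    absolute value and [(y, A y)] lies in the sector of half-angle [alpha],
    [Re (zeta (y, A y)) >= 0]; only the quadratic term [|zeta|^2 |A y|^2] can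
    increase the norm. *)
Lemma norm_rotated_step {H : NormedModule C_AbsRing} (dot : inner_product H)
    (alpha : R) (T : H -> H) (l N k : nat) (y : H) :
  0 <= alpha < PI / 2 -> nonexpansive T -> (0 < l)%nat ->
  (forall u, 0 <= fst (dot u (minus u (T u)))) ->
  (forall u, Rabs (snd (dot u (minus u (T u)))) * cos alpha <=
     sin alpha * fst (dot u (minus u (T u)))) ->
  norm (pencil (euler_step T l)
          (fun z => scal (RtoC (- (cos alpha / INR l))) (minus z (T z))) N k y) <=
  (1 + 8 / INR l ^ 2) * norm y.
Proof.
  intros Ha CT Hl Re0 Sec.
  assert (HL : 0 < INR l) by (apply lt_0_INR; lia).
  assert (Hc : 0 < cos alpha) by (apply cos_gt_0; lra).
  pose proof (COS_bound alpha); pose proof (SIN_bound alpha).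
  unfold pencil, euler_step, root; set (t := 2 * PI * INR k / INR N).
  set (a := minus y (T y)).
  set (c := cos alpha) in *; set (s := sin alpha) in *.
  set (zeta := (((1 + c * cos t) / INR l, c * sin t / INR l) : C)).
  replace (plus _ _) with (minus y (scal zeta a) : H).
  2: { vec_coefs; apply injective_projections; simpl; field; lra. }
  specialize (Re0 y); specialize (Sec y); fold a in Re0, Sec.
  assert (Hac : 0 <= Re (dot y (scal zeta a))).
  { rewrite (ip_scal_r _ dot); unfold Re; simpl.
    replace ((1 + c * cos t) / INR l * fst (dot y a) - c * sin t / INR l * snd (dot y a))
      with (/ INR l * ((1 + c * cos t) * fst (dot y a) - c * sin t * snd (dot y a)))
      by (field; lra).
    apply Rmult_le_pos; [left; now apply Rinv_0_lt_compat|].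
    assert (c * sin t * snd (dot y a) <= Rabs (sin t) * s * fst (dot y a)).
    { eapply Rle_trans; [apply Rle_abs|].
      rewrite !Rabs_mult, (Rabs_right c) by lra.
      pose proof (Rabs_pos (sin t)); nra. }
    assert (- 1 <= c * cos t - s * Rabs (sin t)).
    { pose proof (sin2_cos2 alpha) as T2; unfold Rsqr in T2; fold c s in T2.
      unfold Rabs; destruct (Rcase_abs (sin t)).
      - pose proof (cos_sin_le (- c) (- s) t 1 ltac:(lra) ltac:(nra)); lra.
      - pose proof (cos_sin_le (- c) s t 1 ltac:(lra) ltac:(nra)); lra. }
    nra. }
  assert (Hz : fst zeta ^ 2 + snd zeta ^ 2 <= 4 / INR l ^ 2).
  { unfold zeta; simpl fst; simpl snd.
    pose proof (sin2_cos2 t) as T2; unfold Rsqr in T2; pose proof (COS_bound t).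
    replace (((1 + c * cos t) / INR l) ^ 2 + (c * sin t / INR l) ^ 2) with
      ((1 + 2 * c * cos t + c ^ 2 * (sin t * sin t + cos t * cos t)) / INR l ^ 2) by (field; lra).
    rewrite T2; unfold Rdiv; apply Rmult_le_compat_r; [|nra].
    left; apply Rinv_0_lt_compat; nra. }
  pose proof (norm_defect T y CT) as Na; fold a in Na.
  pose proof (norm_ge_0 a); pose proof (norm_ge_0 y).
  assert (Hl2 : 0 < / INR l ^ 2) by (apply Rinv_0_lt_compat; nra).
  apply Rsqr_incr_0_var; [|apply Rmult_le_pos; unfold Rdiv; lra].
  rewrite !Rsqr_pow2, (norm_minus_sqr dot), (norm_scal_sqr dot).
  assert (norm a ^ 2 <= 4 * norm y ^ 2) by nra.
  assert ((fst zeta ^ 2 + snd zeta ^ 2) * norm a ^ 2 <= 4 / INR l ^ 2 * (4 * norm y ^ 2)).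
  { apply Rmult_le_compat; try assumption; nra. }
  pose proof (pow2_ge_0 (norm y)).
  unfold Rdiv in *; nra.
Qed.

(** [pencil_cauchy] for the rotated step, whose [l k]-th power is bounded by
    [(1 + 8 / l^2)^(l k)].  Dividing by the degree [l k] and by the radius
    [cos alpha / l] leaves [k cos alpha]. *)
Lemma euler_analytic {H : NormedModule C_AbsRing} (dot : inner_product H)
    (alpha : R) (T : H -> H) (l k : nat) (y : H) :
  0 <= alpha < PI / 2 -> Clinear T -> nonexpansive T -> (0 < l)%nat -> (0 < k)%nat ->
  (forall u, 0 <= fst (dot u (minus u (T u)))) ->
  (forall u, Rabs (snd (dot u (minus u (T u)))) * cos alpha <=
     sin alpha * fst (dot u (minus u (T u)))) ->
  let x := Nat.iter (l * k) (euler_step T l) y in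
  norm (minus x (T x)) <= exp (8 * INR k / INR l) / (INR k * cos alpha) * norm y.
Proof.
  intros Ha LT CT Hl Hk Re0 Sec x.
  assert (HL : 0 < INR l) by (apply lt_0_INR; lia).
  assert (HK : 0 < INR k) by (apply lt_0_INR; lia).
  assert (Hc : 0 < cos alpha) by (apply cos_gt_0; lra).
  set (P := euler_step T l) in *.
  set (A := fun z : H => minus z (T z)).
  set (Q := fun z : H => scal (RtoC (- (cos alpha / INR l))) (minus z (T z))).
  assert (LA : Clinear A) by now apply defect_linear.
  assert (LP : Clinear P) by now apply euler_step_linear.
  assert (LQ : Clinear Q).
  { destruct LT as [LP1 LS1]; split; intros; unfold Q; rewrite ?LP1, ?LS1; vec. }
  assert (AP : forall z, A (P z) = P (A z)).
  { intros z; unfold A, P, euler_step.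
    rewrite !(Clinear_minus T) by exact LT.
    rewrite (proj2 LT), !(Clinear_minus T) by exact LT; vec. }
  assert (PQ : forall z, P (Q z) = Q (P z)).
  { intros z; change (P (scal (RtoC (- (cos alpha / INR l))) (A z)) =
      scal (RtoC (- (cos alpha / INR l))) (A (P z))).
    rewrite (proj2 LP), AP; reflexivity. }
  set (m := (l * k)%nat) in *.
  assert (Hm : INR m = INR l * INR k) by apply mult_INR.
  assert (HB : 0 <= 8 / INR l ^ 2).
  { apply Rdiv_le_0_compat; nra. }
  pose proof (pencil_cauchy dot P Q m (1 + 8 / INR l ^ 2) y LP LQ PQ ltac:(lra)
    (fun N k z => norm_rotated_step dot alpha T l N k z Ha CT Hl Re0 Sec)) as Cau.
  assert (E1 : norm (Nat.iter (m - 1) P (Q y)) =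
               cos alpha / INR l * norm (Nat.iter (m - 1) P (A y))).
  { unfold Q; rewrite (proj2 (Clinear_iter P (m - 1) LP)).
    rewrite RtoC_opp.
    replace (scal (Copp (RtoC (cos alpha / INR l))) _) with
      (opp (scal (RtoC (cos alpha / INR l)) (Nat.iter (m - 1) P (A y))) : H) by (unfold A; vec).
    etransitivity; [exact (@norm_opp C_AbsRing H _)|].
    rewrite (norm_scal_R dot); [reflexivity|].
    apply Rdiv_le_0_compat; lra. }
  assert (E2 : norm (A x) <= norm (Nat.iter (m - 1) P (A y))).
  { unfold x; rewrite (iter_commute A P m y AP).
    replace (Nat.iter m P (A y)) with (P (Nat.iter (m - 1) P (A y))).
    2: { change (Nat.iter (S (m - 1)) P (A y) = Nat.iter m P (A y)).
         f_equal; unfold m; nia. }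
    exact (euler_step_nonexpansive dot T l CT Hl _). }
  assert (E3 : (1 + 8 / INR l ^ 2) ^ m <= exp (8 * INR k / INR l)).
  { replace (8 * INR k / INR l) with (INR m * (8 / INR l ^ 2)) by (rewrite Hm; field; lra).
    generalize m; intro j; induction j as [|j IH].
    - simpl; rewrite Rmult_0_l, exp_0; lra.
    - rewrite S_INR, Rmult_plus_distr_r, exp_plus, Rmult_1_l.
      change ((1 + 8 / INR l ^ 2) ^ S j) with
        ((1 + 8 / INR l ^ 2) * (1 + 8 / INR l ^ 2) ^ j).
      rewrite Rmult_comm; apply Rmult_le_compat; [apply pow_le; lra|lra|exact IH|].
      apply exp_ineq1_le. }
  change (minus x (T x)) with (A x).
  apply (Rmult_le_reg_l (INR k * cos alpha)); [now apply Rmult_lt_0_compat|].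
  replace (INR k * cos alpha * (exp (8 * INR k / INR l) / (INR k * cos alpha) * norm y))
    with (exp (8 * INR k / INR l) * norm y) by (field; lra).
  rewrite E1, Hm in Cau.
  replace (INR l * INR k * (cos alpha / INR l * norm (Nat.iter (m - 1) P (A y)))) with
    (INR k * cos alpha * norm (Nat.iter (m - 1) P (A y))) in Cau by (field; lra).
  pose proof (norm_ge_0 y).
  assert (0 < INR k * cos alpha) by now apply Rmult_lt_0_compat.
  eapply Rle_trans; [apply Rmult_le_compat_l; [lra|exact E2]|].
  eapply Rle_trans; [exact Cau|].
  apply Rmult_le_compat_r; assumption.
Qed.

(** * Comparison of the powers with the Euler scheme *)

(** [T^n - F^n] is the sum of the [T^(n-1-k) (T - F) F^k]. *)
Lemma telescope {H : NormedModule C_AbsRing} (T F : H -> H) (n : nat) (x : H) :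
  Clinear T ->
  norm (minus (Nat.iter n T x) (Nat.iter n F x)) <=
  bsum (fun k => norm (Nat.iter (n - 1 - k) T
     (minus (T (Nat.iter k F x)) (F (Nat.iter k F x))))) n.
Proof.
  intros LT; revert x; induction n as [|n IH]; intros x.
  - simpl; rewrite minus_eq_zero; right; exact (@norm_zero C_AbsRing H).
  - rewrite !Nat.iter_succ_r, bsum_S_l.
    replace (minus (Nat.iter n T (T x)) (Nat.iter n F (F x))) with
      (plus (Nat.iter n T (minus (T x) (F x)))
            (minus (Nat.iter n T (F x)) (Nat.iter n F (F x))) : H).
    2: { rewrite (Clinear_minus (Nat.iter n T)) by (now apply Clinear_iter); vec. }
    eapply Rle_trans; [exact (@norm_triangle C_AbsRing H _ _)|].
    apply Rplus_le_compat.
    + replace (S n - 1 - 0)%nat with n by lia; apply Rle_refl.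
    + eapply Rle_trans; [apply IH|]; apply bsum_le; intros k Hk.
      rewrite Nat.iter_succ_r; replace (S n - 1 - S k)%nat with (n - 1 - k)%nat by lia.
      apply Rle_refl.
Qed.

Lemma euler_step_defect {H : NormedModule C_AbsRing} (T : H -> H) (l : nat) (z : H) :
  Clinear T ->
  minus (euler_step T l z) (T (euler_step T l z)) =
  euler_step T l (minus z (T z)).
Proof.
  intros LT; unfold euler_step.
  rewrite !(Clinear_minus T), (proj2 LT), !(Clinear_minus T) by exact LT; vec.
Qed.

(** Second-order consistency.  With [D = 1 - A / l], the difference
    [D^l - (1 - A)] is [A^2 / l^2] times the sum of [l (l - 1) / 2] powers of [D],
    hence [A^2 / 2] up to contractions.  One factor [A] is absorbed, together
    with [T^j], by [beta]; the other is kept. *)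
Lemma euler_consistency {H : NormedModule C_AbsRing} (dot : inner_product H)
    (T : H -> H) (l j : nat) (beta : R) (w : H) :
  Clinear T -> nonexpansive T -> (0 < l)%nat -> 0 <= beta ->
  (forall z, norm (Nat.iter j T (minus z (T z))) <= beta * norm z) ->
  norm (Nat.iter j T (minus (T w) (Nat.iter l (euler_step T l) w))) <=
  beta / 2 * norm (minus w (T w)).
Proof.
  intros LT CT Hl Hb E.
  set (P := euler_step T l).
  set (A := fun z : H => minus z (T z)).
  assert (LA : Clinear A) by now apply defect_linear.
  assert (CP : nonexpansive P) by now apply (euler_step_nonexpansive dot).
  assert (AP : forall z, A (P z) = P (A z)) by (intro z; now apply euler_step_defect).
  pose proof (Clinear_iter T j LT) as LJ.
  assert (HL : 0 < INR l) by (apply lt_0_INR; lia).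
  assert (HI : 0 < / INR l) by now apply Rinv_0_lt_compat.
  pose proof (norm_ge_0 (A w)) as NA.
  assert (Step : forall i, Nat.iter (S i) P w =
    minus (Nat.iter i P w) (scal (RtoC (/ INR l)) (A (Nat.iter i P w)))) by reflexivity.
  assert (G : forall i, norm (Nat.iter j T (A (minus w (Nat.iter i P w)))) <=
    INR i / INR l * (beta * norm (A w))).
  { induction i as [|i IH].
    - replace (minus w (Nat.iter 0 P w)) with (zero : H) by (simpl; vec).
      rewrite (Clinear_zero A LA), (Clinear_zero _ LJ); simpl.
      unfold Rdiv; rewrite !Rmult_0_l; right; exact (@norm_zero C_AbsRing H).
    - rewrite Step.
      replace (minus w (minus (Nat.iter i P w) (scal (RtoC (/ INR l)) (A (Nat.iter i P w)))))
        with (plus (minus w (Nat.iter i P w)) (scal (RtoC (/ INR l)) (A (Nat.iter i P w))) : H)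
        by vec.
      rewrite (proj1 LA), (proj2 LA), (proj1 LJ), (proj2 LJ).
      eapply Rle_trans; [exact (@norm_triangle C_AbsRing H _ _)|].
      rewrite (norm_scal_R dot) by lra.
      assert (norm (Nat.iter j T (A (A (Nat.iter i P w)))) <= beta * norm (A w)).
      { eapply Rle_trans; [apply E|]; apply Rmult_le_compat_l; [exact Hb|].
        rewrite (iter_commute A P i w AP); apply nonexpansive_iter, CP. }
      rewrite S_INR; unfold Rdiv in *; nra. }
  assert (Q : forall i, norm (Nat.iter j T (plus (minus (Nat.iter i P w) w)
      (scal (RtoC (INR i / INR l)) (A w)))) <=
    INR i ^ 2 / (2 * INR l ^ 2) * (beta * norm (A w))).
  { induction i as [|i IH].
    - simpl Nat.iter at 2.
      replace (plus (minus w w) (scal (RtoC (INR 0 / INR l)) (A w))) with (zero : H).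
      2: { simpl INR; unfold Rdiv; rewrite Rmult_0_l; vec. }
      rewrite (Clinear_zero _ LJ); simpl.
      unfold Rdiv; rewrite !Rmult_0_l; right; exact (@norm_zero C_AbsRing H).
    - replace (plus (minus (Nat.iter (S i) P w) w) (scal (RtoC (INR (S i) / INR l)) (A w)))
        with (plus (plus (minus (Nat.iter i P w) w) (scal (RtoC (INR i / INR l)) (A w)))
               (scal (RtoC (/ INR l)) (A (minus w (Nat.iter i P w)))) : H).
      2: { rewrite Step, (Clinear_minus A), S_INR by exact LA.
           unfold Rdiv; rewrite Rmult_plus_distr_r, Rmult_1_l, RtoC_plus; vec. }
      rewrite (proj1 LJ), (proj2 LJ).
      eapply Rle_trans; [exact (@norm_triangle C_AbsRing H _ _)|].
      rewrite (norm_scal_R dot) by lra.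
      specialize (G i).
      set (c := beta * norm (A w)) in *.
      assert (Hc : 0 <= c) by (unfold c; nra).
      eapply Rle_trans; [apply Rplus_le_compat; [exact IH|]|].
      { apply Rmult_le_compat_l; [lra|exact G]. }
      rewrite S_INR.
      replace (INR i ^ 2 / (2 * INR l ^ 2) * c + / INR l * (INR i / INR l * c)) with
        ((INR i ^ 2 + 2 * INR i) * (c / (2 * INR l ^ 2))) by (field; lra).
      replace ((INR i + 1) ^ 2 / (2 * INR l ^ 2) * c) with
        ((INR i + 1) ^ 2 * (c / (2 * INR l ^ 2))) by (field; lra).
      apply Rmult_le_compat_r; [|nra].
      apply Rdiv_le_0_compat; nra. }
  specialize (Q l).
  replace (INR l ^ 2 / (2 * INR l ^ 2) * (beta * norm (A w))) with
    (beta / 2 * norm (A w)) in Q by (field; lra).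
  replace (minus (T w) (Nat.iter l P w)) with
    (scal (Copp (RtoC 1)) (plus (minus (Nat.iter l P w) w)
       (scal (RtoC (INR l / INR l)) (A w))) : H).
  2: { unfold Rdiv; rewrite Rinv_r by lra; unfold A; vec. }
  rewrite (proj2 LJ).
  eapply Rle_trans; [apply norm_scal_Cmod|].
  rewrite Cmod_opp, Cmod_1, Rmult_1_l; exact Q.
Qed.

(** Each step uses [1 / (r + 1) <= ln ((r + 1) / r)], that is,
    [1 - 1 / (r + 1) <= exp (- 1 / (r + 1))]. *)
Lemma harmonic_le (p : nat) : (0 < p)%nat -> bsum (fun k => / INR (S k)) p <= 1 + ln (INR p).
Proof.
  induction p as [|[|p] IH]; intros Hp; [lia| |].
  - simpl; unfold plus, zero; simpl; rewrite ln_1, Rinv_1; lra.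
  - specialize (IH ltac:(lia)).
    change (bsum (fun k => / INR (S k)) (S p) + / INR (S (S p)) <= 1 + ln (INR (S (S p)))).
    assert (H0 : 0 < INR (S p)) by (apply lt_0_INR; lia).
    rewrite (S_INR (S p)).
    set (r := INR (S p)) in *.
    assert (E : 1 + - / (r + 1) <= exp (- / (r + 1))) by apply exp_ineq1_le.
    replace (1 + - / (r + 1)) with (r / (r + 1)) in E by (field; lra).
    assert (Hq : 0 < r / (r + 1)) by (apply Rdiv_lt_0_compat; lra).
    apply ln_le in E; [|exact Hq].
    rewrite ln_exp, ln_div in E by lra; lra.
Qed.

Lemma sum_inv_sqrt (p : nat) :
  bsum (fun k => / sqrt (INR (p - k))) p <= 2 * sqrt (INR p).
Proof.
  induction p as [|p IH]; [simpl; unfold zero; simpl; rewrite sqrt_0; lra|].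
  rewrite bsum_S_l; simpl Nat.sub.
  change (/ sqrt (INR (S p)) + bsum (fun k => / sqrt (INR (p - k))) p <=
          2 * sqrt (INR (S p))).
  rewrite S_INR.
  assert (H0 : 0 <= INR p) by apply pos_INR.
  pose proof (sqrt_pos (INR p)).
  assert (0 < sqrt (INR p + 1)) by (apply sqrt_lt_R0; lra).
  pose proof (pow2_sqrt (INR p) H0).
  pose proof (pow2_sqrt (INR p + 1) ltac:(lra)).
  set (a := sqrt (INR p)) in *; set (b := sqrt (INR p + 1)) in *.
  assert (/ b <= 2 * b - 2 * a).
  { apply (Rmult_le_reg_l b); [assumption|]; rewrite Rinv_r by lra; nra. }
  lra.
Qed.

(** With [m = p - k], the partial fraction
    [(p + 1) / ((k + 1) m) = 1 / (k + 1) + 1 / m] splits the sum into a harmonic sum and a sum of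
    inverse square roots. *)
Lemma convolution_sum (p : nat) :
  bsum (fun k => / (INR (S k) * sqrt (INR (p - k)))) p <=
  (3 + ln (INR (S p))) / sqrt (INR (S p)).
Proof.
  assert (HN : 0 < INR (S p)) by (apply lt_0_INR; lia).
  assert (HS : 0 < sqrt (INR (S p))) by now apply sqrt_lt_R0.
  pose proof (pow2_sqrt (INR (S p)) ltac:(lra)) as E.
  apply Rle_trans with (bsum (fun k => plus (/ sqrt (INR (S p)) * / INR (S k))
       (/ INR (S p) * / sqrt (INR (p - k)))) p).
  - apply bsum_le; intros k Hk.
    assert (Hm : 0 < INR (p - k)) by (apply lt_0_INR; lia).
    assert (Hk1 : 0 < INR (S k)) by (apply lt_0_INR; lia).
    assert (Hsum : INR (S p) = INR (S k) + INR (p - k)).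
    { rewrite <- plus_INR; f_equal; lia. }
    assert (Hq : 0 < sqrt (INR (p - k))) by now apply sqrt_lt_R0.
    pose proof (pow2_sqrt (INR (p - k)) ltac:(lra)) as Eq.
    assert (sqrt (INR (p - k)) <= sqrt (INR (S p))) by (apply sqrt_le_1_alt; lra).
    unfold plus; simpl AbelianMonoid.sort.
    set (q := sqrt (INR (p - k))) in *; set (r := sqrt (INR (S p))) in *.
    set (m := INR (p - k)) in *; set (i := INR (S k)) in *.
    rewrite Hsum in *.
    change (/ (i * q) <= / r * / i + / (i + m) * / q).
    rewrite <- E.
    replace (/ r * / i + / r ^ 2 * / q) with ((r * q + i) / (i * q * r ^ 2)) by (field; lra).
    replace (/ (i * q)) with ((m + i) / (i * q * r ^ 2)).
    2: { rewrite E; field; lra. }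
    unfold Rdiv; apply Rmult_le_compat_r.
    + left; apply Rinv_0_lt_compat; repeat apply Rmult_lt_0_compat; try assumption; lra.
    + nra.
  - rewrite bsum_plus, !bsum_Rscal.
    change (/ sqrt (INR (S p)) * bsum (fun k => / INR (S k)) p +
      / INR (S p) * bsum (fun k => / sqrt (INR (p - k))) p <=
      (3 + ln (INR (S p))) / sqrt (INR (S p))).
    assert (B1 : bsum (fun k => / INR (S k)) p <= 1 + ln (INR (S p))).
    { destruct p as [|p].
      - simpl; unfold zero; simpl; rewrite ln_1; lra.
      - eapply Rle_trans; [apply harmonic_le; lia|].
        apply Rplus_le_compat_l, ln_le; [apply lt_0_INR; lia|apply le_INR; lia]. }
    assert (B2 : bsum (fun k => / sqrt (INR (p - k))) p <= 2 * sqrt (INR (S p))).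
    { eapply Rle_trans; [apply sum_inv_sqrt|].
      apply Rmult_le_compat_l; [lra|]; apply sqrt_le_1_alt, le_INR; lia. }
    apply Rle_trans with (/ sqrt (INR (S p)) * (1 + ln (INR (S p))) +
      / INR (S p) * (2 * sqrt (INR (S p)))).
    + apply Rplus_le_compat; apply Rmult_le_compat_l; try assumption;
        left; apply Rinv_0_lt_compat; assumption.
    + set (L := ln (INR (S p))); set (q := sqrt (INR (S p))) in *.
      rewrite <- E; right; field; lra.
Qed.

Lemma exp_monotone (x y : R) : x <= y -> exp x <= exp y.
Proof. intros [L| ->]; [left; now apply exp_increasing|apply Rle_refl]. Qed.

Lemma iter_iter {X : Type} (f : X -> X) (l k : nat) (x : X) :
  Nat.iter k (Nat.iter l f) x = Nat.iter (l * k) f x.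
Proof.
  induction k as [|k IH]; [now rewrite Nat.mul_0_r|].
  rewrite Nat.mul_succ_r, Nat.add_comm, Nat.iter_add, <- IH; reflexivity.
Qed.

(** In each term of [telescope], [euler_consistency] leaves one factor for
    [power_decay] and one for [euler_analytic]; the term [k = 0], where the latter
    says nothing, is bounded with [|A| <= 2]. *)
Lemma power_euler_distance {H : NormedModule C_AbsRing} (dot : inner_product H)
    (alpha delta : R) (T : H -> H) (l p : nat) (x : H) :
  0 <= alpha < PI / 2 -> 0 < delta -> Clinear T -> nonexpansive T -> (0 < l)%nat ->
  (forall u, Rabs (snd (dot u (minus u (T u)))) * cos alpha <=
     sin alpha * fst (dot u (minus u (T u)))) ->
  (forall t u, cos t * fst (dot u (T u)) + sin t * snd (dot u (T u)) <=
     (1 - delta * (1 - cos t)) * norm u ^ 2) ->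
  let n := S p in
  norm (minus (Nat.iter n T x) (Nat.iter (l * n) (euler_step T l) x)) <=
  exp (8 * INR n / INR l) *
    ((2 + (3 + ln (INR n)) / cos alpha) / sqrt (delta * INR n)) * norm x.
Proof.
  intros Ha Hd LT CT Hl Sec Disc n.
  assert (Hc : 0 < cos alpha) by (apply cos_gt_0; lra).
  assert (HL : 0 < INR l) by (apply lt_0_INR; lia).
  assert (Re0 : forall u, 0 <= fst (dot u (minus u (T u)))).
  { intros u; specialize (Disc 0 u); rewrite cos_0, sin_0 in Disc.
    rewrite ip_minus_r, (ip_norm _ dot); simpl; simpl in Disc; lra. }
  set (P := euler_step T l).
  set (E := exp (8 * INR n / INR l)).
  assert (HE : 1 <= E).
  { unfold E; rewrite <- exp_0; apply exp_monotone.
    apply Rdiv_le_0_compat; [pose proof (pos_INR n); lra|lra]. }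
  pose proof (norm_ge_0 x) as Nx.
  set (F := Nat.iter l P).
  assert (Dec : forall j w, norm (Nat.iter j T (minus (T w) (F w))) <=
    / sqrt (delta * INR (S j)) * norm (minus w (T w))).
  { intros j w.
    assert (HJ : 0 < sqrt (delta * INR (S j))).
    { apply sqrt_lt_R0, Rmult_lt_0_compat; [exact Hd|apply lt_0_INR; lia]. }
    pose proof (euler_consistency dot T l j (2 / sqrt (delta * INR (S j))) w LT CT Hl
      ltac:(apply Rdiv_le_0_compat; lra)
      (fun z => power_decay dot T delta z j Hd LT CT Disc)) as Q.
    replace (2 / sqrt (delta * INR (S j)) / 2) with (/ sqrt (delta * INR (S j))) in Q
      by (field; lra).
    exact Q. }
  rewrite <- iter_iter; fold F.
  eapply Rle_trans; [apply telescope, LT|].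
  change (bsum ?f n) with (bsum f (S p)); rewrite bsum_S_l.
  assert (HN : 0 < INR n) by (apply lt_0_INR; unfold n; lia).
  assert (Hsd : 0 < sqrt delta) by now apply sqrt_lt_R0.
  assert (Hsn : 0 < sqrt (INR n)) by now apply sqrt_lt_R0.
  apply Rle_trans with (/ sqrt (delta * INR n) * (2 * norm x) +
    E / (cos alpha * sqrt delta) * norm x * ((3 + ln (INR n)) / sqrt (INR n))).
  - apply Rplus_le_compat.
    + eapply Rle_trans; [apply Dec|].
      replace (S (n - 1 - 0)) with n by (unfold n; lia).
      apply Rmult_le_compat_l; [|now apply norm_defect].
      left; apply Rinv_0_lt_compat, sqrt_lt_R0; nra.
    + apply Rle_trans with (bsum (fun k => E / (cos alpha * sqrt delta) * norm x *
        / (INR (S k) * sqrt (INR (p - k)))) p).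
      * apply bsum_le; intros k Hk.
        eapply Rle_trans; [apply Dec|].
        replace (S (n - 1 - S k)) with (p - k)%nat by (unfold n; lia).
        assert (Hm : 0 < INR (p - k)) by (apply lt_0_INR; lia).
        assert (Hk1 : 0 < INR (S k)) by (apply lt_0_INR; lia).
        assert (Hq : 0 < sqrt (INR (p - k))) by now apply sqrt_lt_R0.
        rewrite sqrt_mult by lra.
        unfold F; rewrite iter_iter.
        pose proof (euler_analytic dot alpha T l (S k) x Ha LT CT Hl ltac:(lia) Re0 Sec) as An.
        cbv zeta in An; fold P in An.
        assert (EE : exp (8 * INR (S k) / INR l) <= E).
        { apply exp_monotone; unfold Rdiv; apply Rmult_le_compat_r.
          - left; now apply Rinv_0_lt_compat.
          - apply Rmult_le_compat_l; [lra|apply le_INR; unfold n; lia]. }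
        apply Rle_trans with (/ (sqrt delta * sqrt (INR (p - k))) *
          (E / (INR (S k) * cos alpha) * norm x)).
        -- apply Rmult_le_compat_l.
           { left; apply Rinv_0_lt_compat; now apply Rmult_lt_0_compat. }
           eapply Rle_trans; [exact An|].
           apply Rmult_le_compat_r; [exact Nx|].
           unfold Rdiv; apply Rmult_le_compat_r; [|exact EE].
           left; apply Rinv_0_lt_compat; now apply Rmult_lt_0_compat.
        -- right; field; repeat split; lra.
      * rewrite bsum_Rscal; apply Rmult_le_compat_l; [|apply convolution_sum].
        apply Rmult_le_pos; [|exact Nx]; apply Rdiv_le_0_compat; [lra|].
        now apply Rmult_lt_0_compat.
  - rewrite sqrt_mult by lra.
    set (d := sqrt delta) in *; set (q := sqrt (INR n)) in *.
    replace (E * ((2 + (3 + ln (INR n)) / cos alpha) / (d * q)) * norm x) with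
      (E * (/ (d * q) * (2 * norm x)) +
       E / (cos alpha * d) * norm x * ((3 + ln (INR n)) / q)) by (field; lra).
    apply Rplus_le_compat_r.
    assert (0 <= / (d * q) * (2 * norm x)).
    { apply Rmult_le_pos; [|lra]; left; apply Rinv_0_lt_compat; nra. }
    nra.
Qed.

(** * Euler's limit for the operator exponential *)

(** Binomial coefficients by Pascal's rule, vanishing for [k > n], so that
    binomial sums may be taken over any longer range. *)
Fixpoint binom (n k : nat) : nat :=
  match n, k with
  | _, O => 1
  | O, S _ => 0
  | S n', S k' => binom n' k' + binom n' (S k')
  end.

Lemma binom_0_r (n : nat) : binom n 0 = 1%nat.
Proof. destruct n; reflexivity. Qed.

Lemma binom_gt (n k : nat) : (n < k)%nat -> binom n k = 0%nat.
Proof.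
  revert k; induction n as [|n IH]; intros [|k] Hk; simpl; try lia.
  rewrite !IH; lia.
Qed.

Lemma pow_succ_ge (n k : nat) : (n ^ S k + S k * n ^ k <= (n + 1) ^ S k)%nat.
Proof.
  induction k as [|k IH]; [simpl; lia|].
  rewrite (Nat.pow_succ_r' (n + 1) (S k)).
  rewrite (Nat.pow_succ_r' n (S k)), (Nat.pow_succ_r' n k) in *; nia.
Qed.

Lemma binom_le (n k : nat) : (binom n k * fact k <= n ^ k)%nat.
Proof.
  revert k; induction n as [|n IH]; intros [|k]; simpl binom.
  - simpl; lia.
  - lia.
  - simpl; lia.
  - pose proof (IH k) as A1; pose proof (IH (S k)) as A2.
    pose proof (pow_succ_ge n k) as A3.
    replace (S n) with (n + 1)%nat by lia.
    rewrite Nat.mul_add_distr_r.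
    change (fact (S k)) with (S k * fact k)%nat in *; nia.
Qed.

Lemma binomial_iter {H : NormedModule C_AbsRing} (Y : H -> H) (u : H) (n m : nat) :
  Clinear Y -> (n < m)%nat ->
  Nat.iter n (fun v => plus v (Y v)) u =
  bsum (fun k => scal (RtoC (INR (binom n k))) (Nat.iter k Y u)) m.
Proof.
  intros LY; revert m; induction n as [|n IH]; intros [|m] Hm; try lia.
  - rewrite bsum_S_l; simpl binom.
    rewrite (bsum_ext _ (fun _ => zero)) by (intros; apply scal_C0).
    rewrite bsum_zero; simpl; rewrite scal_C1; symmetry; apply plus_zero_r.
  - change (Nat.iter (S n) _ u) with
      (plus (Nat.iter n (fun v => plus v (Y v)) u) (Y (Nat.iter n (fun v => plus v (Y v)) u))).
    rewrite (IH (S m)) by lia.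
    rewrite (Clinear_bsum Y) by exact LY.
    rewrite bsum_S_l.
    change (bsum (fun i => Y (scal (RtoC (INR (binom n i))) (Nat.iter i Y u))) (S m)) with
      (plus (bsum (fun i => Y (scal (RtoC (INR (binom n i))) (Nat.iter i Y u))) m)
         (Y (scal (RtoC (INR (binom n m))) (Nat.iter m Y u)))).
    rewrite (proj2 LY (RtoC (INR (binom n m)))), (binom_gt n m), scal_C0 by lia.
    rewrite bsum_S_l, !binom_0_r.
    rewrite (bsum_ext (fun i => scal (RtoC (INR (binom (S n) (S i)))) (Nat.iter (S i) Y u))
      (fun i => plus (Y (scal (RtoC (INR (binom n i))) (Nat.iter i Y u)))
         (scal (RtoC (INR (binom n (S i)))) (Nat.iter (S i) Y u)))).
    2: { intros i _; simpl binom; rewrite plus_INR, RtoC_plus, scal_Cplus, (proj2 LY); reflexivity. }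
    rewrite (bsum_plus (G := NormedModule.AbelianMonoid _ H)).
    rewrite plus_zero_r; etransitivity; [symmetry; apply plus_assoc|].
    f_equal; apply plus_comm.
Qed.

Lemma binomial_R (t : R) (n m : nat) :
  (n < m)%nat -> bsum (fun k => INR (binom n k) * t ^ k) m = (1 + t) ^ n.
Proof.
  revert m; induction n as [|n IH]; intros [|m] Hm; try lia.
  - rewrite bsum_S_l, (bsum_ext _ (fun _ => zero)).
    + rewrite bsum_zero; simpl; rewrite plus_zero_r; ring.
    + intros i _; simpl; apply Rmult_0_l.
  - transitivity (bsum (fun k => INR (binom n k) * t ^ k) (S m) +
      t * bsum (fun k => INR (binom n k) * t ^ k) m).
    2: { rewrite !IH by lia; simpl; ring. }
    rewrite !bsum_S_l, !binom_0_r, <- bsum_Rscal.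
    rewrite (bsum_ext (fun i => INR (binom (S n) (S i)) * t ^ S i)
      (fun i => plus (INR (binom n (S i)) * t ^ S i) (t * (INR (binom n i) * t ^ i)))).
    2: { intros i _; simpl binom; rewrite plus_INR; unfold plus; simpl; ring. }
    rewrite bsum_plus; unfold plus; simpl; ring.
Qed.

Lemma sum_n_bsum {G : AbelianMonoid} (f : nat -> G) (n : nat) : sum_n f n = bsum f (S n).
Proof.
  induction n as [|n IH]; [rewrite sum_O; simpl; now rewrite plus_zero_l|].
  now rewrite sum_Sn, IH.
Qed.

Lemma exp_is_series (x : R) : is_series (fun k => / INR (fact k) * x ^ k) (exp x).
Proof. apply is_pseries_R, is_exp_Reals. Qed.

Lemma exp_partial_sum_le (x : R) (n : nat) :
  0 <= x -> bsum (fun k => / INR (fact k) * x ^ k) n <= exp x.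
Proof.
  intros Hx.
  assert (Pos : forall k, 0 <= / INR (fact k) * x ^ k).
  { intro k; apply Rmult_le_pos; [left; apply Rinv_0_lt_compat, INR_fact_lt_0|].
    now apply pow_le. }
  apply Rle_trans with (bsum (fun k => / INR (fact k) * x ^ k) (S n)).
  - simpl; unfold plus; simpl; pose proof (Pos n); lra.
  - rewrite <- sum_n_bsum.
    apply (is_lim_seq_incr_compare (sum_n (fun k => / INR (fact k) * x ^ k))).
    + apply exp_is_series.
    + intro k; rewrite sum_Sn; unfold plus; simpl; pose proof (Pos (S k)); simpl in *; lra.
Qed.

Lemma norm_iter_le {H : NormedModule C_AbsRing} (X : H -> H) (M : R) (u : H) (k : nat) :
  0 <= M -> (forall v, norm (X v) <= M * norm v) -> norm (Nat.iter k X u) <= M ^ k * norm u.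
Proof.
  intros HM B; induction k as [|k IH]; simpl; [lra|].
  eapply Rle_trans; [apply B|]; rewrite Rmult_assoc; now apply Rmult_le_compat_l.
Qed.

Definition exp_term {H : NormedModule C_AbsRing} (X : H -> H) (u : H) (k : nat) : H :=
  scal (RtoC (/ INR (fact k))) (Nat.iter k X u).

Lemma norm_exp_term {H : NormedModule C_AbsRing} (X : H -> H) (M : R) (u : H) (k : nat) :
  0 <= M -> (forall v, norm (X v) <= M * norm v) ->
  norm (exp_term X u k) <= norm u * (/ INR (fact k) * M ^ k).
Proof.
  intros HM B; unfold exp_term.
  eapply Rle_trans; [apply norm_scal_Cmod|].
  pose proof (INR_fact_lt_0 k) as HF; apply Rinv_0_lt_compat in HF.
  rewrite Cmod_R, Rabs_right by lra.
  pose proof (norm_iter_le X M u k HM B); nra.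
Qed.

(** [op_exp] is a limit chosen by completeness; absolute convergence makes it
    the sum of the series. *)
Lemma op_exp_is_series {H : CompleteNormedModule C_AbsRing} (X : H -> H) (M : R) (u : H) :
  0 <= M -> (forall v : H, norm (X v) <= M * norm v) ->
  is_series (@exp_term H X u) (op_exp X u).
Proof.
  intros HM B.
  assert (Ex : ex_series (@exp_term H X u)).
  { apply (ex_series_le (@exp_term H X u) (fun k => norm u * (/ INR (fact k) * M ^ k))).
    - intro k; exact (@norm_exp_term H X M u k HM B).
    - exists (norm u * exp M).
      apply (is_series_scal_l (norm u) (fun k => / INR (fact k) * M ^ k)), exp_is_series. }
  destruct Ex as [s Hs].
  apply filterlim_locally; intro eps.
  apply (complete_cauchy (filtermap (sum_n (@exp_term H X u)) eventually)).
  - apply filtermap_proper_filter, eventually_filter.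
  - intro e; exists s; apply Hs; now exists e.
Qed.

(** The coefficients of [(1 + X / m)^m] are at most those of the exponential
    series.  So the difference of the two is a series in [X] with nonnegative
    coefficients, and its norm is at most its value at the real number [M]. *)
Lemma euler_exp_distance {H : NormedModule C_AbsRing} (dot : inner_product H)
    (X : H -> H) (M : R) (m : nat) (u e : H) :
  Clinear X -> (0 < m)%nat -> 0 <= M -> (forall v, norm (X v) <= M * norm v) ->
  is_series (exp_term X u) e ->
  norm (minus e
    (Nat.iter m (fun v => plus v (scal (RtoC (/ INR m)) (X v))) u)) <=
  (exp M - (1 + M / INR m) ^ m) * norm u.
Proof.
  intros LX Hm HM B Ser.
  assert (HMm : 0 < INR m) by (apply lt_0_INR; lia).
  set (Y := fun v => scal (RtoC (/ INR m)) (X v) : H).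
  assert (LY : Clinear Y).
  { destruct LX as [P S]; split; intros; unfold Y; rewrite ?P, ?S; vec. }
  set (z := Nat.iter m (fun v => plus v (Y v)) u : H).
  set (a := exp_term X u) in *.
  assert (IY : forall k, Nat.iter k Y u = scal (RtoC (/ INR m ^ k)) (Nat.iter k X u)).
  { induction k as [|k IH].
    - simpl; rewrite Rinv_1; vec.
    - change (Nat.iter (S k) Y u) with (scal (RtoC (/ INR m)) (X (Nat.iter k Y u)) : H).
      rewrite IH, (proj2 LX), <- scal_Cmult, <- RtoC_mult.
      simpl; rewrite Rinv_mult; reflexivity. }
  assert (Part : forall K, (m < K)%nat -> norm (minus (bsum a K) z : H) <=
    (exp M - (1 + M / INR m) ^ m) * norm u).
  { intros K HK; unfold z; rewrite (binomial_iter Y u m K LY HK).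
    set (d := fun k => / INR (fact k) - INR (binom m k) * / INR m ^ k).
    assert (Hd : forall k, 0 <= d k).
    { intro k; unfold d.
      pose proof (INR_fact_lt_0 k) as HF.
      assert (HP : 0 < INR m ^ k) by now apply pow_lt.
      pose proof (le_INR _ _ (binom_le m k)) as L.
      rewrite mult_INR, pow_INR in L.
      replace (/ INR (fact k) - INR (binom m k) * / INR m ^ k) with
        ((INR m ^ k - INR (binom m k) * INR (fact k)) * / (INR (fact k) * INR m ^ k))
        by (field; lra).
      apply Rmult_le_pos; [lra|]; left; apply Rinv_0_lt_compat; now apply Rmult_lt_0_compat. }
    replace (minus (bsum a K) (bsum (fun k => scal (RtoC (INR (binom m k))) (Nat.iter k Y u)) K) : H)
      with (bsum (fun k => scal (RtoC (d k)) (Nat.iter k X u)) K : H).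
    2: { clear - IY; induction K as [|K IH]; [simpl; vec|].
         change (bsum ?f (S K)) with (plus (bsum f K) (f K)).
         rewrite IH; cbv beta; rewrite IY, <- scal_Cmult, <- RtoC_mult; unfold d, a, exp_term.
         rewrite RtoC_minus; vec. }
    eapply Rle_trans; [apply norm_bsum|].
    apply Rle_trans with (bsum (fun k => norm u * (d k * M ^ k)) K).
    - apply bsum_le; intros k _; rewrite (norm_scal_R dot) by apply Hd.
      pose proof (norm_iter_le X M u k HM B); pose proof (Hd k); nra.
    - rewrite bsum_Rscal, Rmult_comm; apply Rmult_le_compat_r; [apply norm_ge_0|].
      rewrite <- (binomial_R (M / INR m) m K HK).
      apply Rle_trans with (bsum (fun k => / INR (fact k) * M ^ k) K -
        bsum (fun k => INR (binom m k) * (M / INR m) ^ k) K).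
      + right; clear - HMm; induction K as [|K IH]; [simpl; unfold zero; simpl; ring|].
        change (bsum ?f (S K)) with (bsum f K + f K).
        rewrite IH; unfold d, Rdiv; rewrite Rpow_mult_distr, pow_inv; ring.
      + pose proof (exp_partial_sum_le M K HM); lra. }
  change (norm (minus e z) <= (exp M - (1 + M / INR m) ^ m) * norm u).
  apply le_epsilon; intros eps Heps.
  pose proof (@norm_factor_gt_0 C_AbsRing H) as HNF.
  assert (Hr : 0 < eps / (2 * @norm_factor C_AbsRing H)) by (apply Rdiv_lt_0_compat; lra).
  set (r := mkposreal _ Hr).
  destruct (proj1 (filterlim_locally _ _) Ser r) as [K0 HK].
  specialize (HK (K0 + m)%nat ltac:(lia)).
  rewrite sum_n_bsum in HK; apply norm_compat2 in HK.
  specialize (Part (S (K0 + m)) ltac:(lia)).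
  change (pos r) with (eps / (2 * @norm_factor C_AbsRing H)) in HK.
  set (s := bsum a (S (K0 + m)) : H) in *.
  replace (minus e z) with (plus (minus s z) (opp (minus s e)) : H) by vec.
  eapply Rle_trans; [exact (@norm_triangle C_AbsRing H _ _)|].
  apply Rplus_le_compat; [exact Part|].
  eapply Rle_trans; [right; exact (@norm_opp C_AbsRing H _)|].
  left; eapply Rlt_le_trans; [exact HK|].
  apply Rle_trans with (eps / 2); [right; field|]; lra.
Qed.

Lemma iter_ext {X : Type} (f g : X -> X) (n : nat) (x : X) :
  (forall y, f y = g y) -> Nat.iter n f x = Nat.iter n g x.
Proof. intros E; induction n as [|n IH]; simpl; [reflexivity|now rewrite IH, E]. Qed.

(** The [m]-th power of [1 - y <= exp (- y)] at [y = x / (1 + x)]. *)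
Lemma pow_1_plus_ge (x : R) (m : nat) : 0 <= x -> exp (INR m * (x / (1 + x))) <= (1 + x) ^ m.
Proof.
  intros Hx; induction m as [|m IH].
  - simpl; rewrite Rmult_0_l, exp_0; lra.
  - rewrite S_INR, Rmult_plus_distr_r, exp_plus, Rmult_1_l, Rmult_comm.
    simpl pow; apply Rmult_le_compat; try (left; apply exp_pos); [|exact IH].
    assert (E : 1 + - (x / (1 + x)) <= exp (- (x / (1 + x)))) by apply exp_ineq1_le.
    replace (1 + - (x / (1 + x))) with (/ (1 + x)) in E by (field; lra).
    rewrite exp_Ropp in E.
    apply Rinv_le_contravar in E; [|apply Rinv_0_lt_compat; lra].
    now rewrite !Rinv_inv in E.
Qed.

(** Passage to the limit [l -> oo]: both the factor [exp (8 n / l)] and the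
    distance of the Euler scheme to the exponential are explicit continuous functions
    of [1 / l]. *)
Lemma euler_limit {H : NormedModule C_AbsRing} (dot : inner_product H)
    (T : H -> H) (n : nat) (b : R) (u w e : H) :
  Clinear T -> nonexpansive T -> (0 < n)%nat ->
  is_series (exp_term (fun v => scal (RtoC (INR n)) (minus (T v) v)) u) e ->
  (forall l, (0 < l)%nat -> norm (minus w (Nat.iter (l * n) (euler_step T l) u)) <=
     exp (8 * INR n / INR l) * b) ->
  norm (minus w e) <= b.
Proof.
  intros LT CT Hn Ser Bd.
  assert (HN : 0 < INR n) by (apply lt_0_INR; lia).
  set (X := fun v : H => scal (RtoC (INR n)) (minus (T v) v) : H) in *.
  assert (LX : Clinear X).
  { destruct LT as [P S]; split; intros; unfold X; rewrite ?P, ?S; vec. }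
  assert (BX : forall v, norm (X v) <= 2 * INR n * norm v).
  { intros v; unfold X; rewrite (norm_scal_R dot) by lra.
    replace (minus (T v) v) with (opp (minus v (T v)) : H) by vec.
    pose proof (@norm_opp C_AbsRing H (minus v (T v))) as E.
    pose proof (norm_defect T v CT).
    apply Rle_trans with (INR n * norm (minus v (T v))); [right; f_equal; exact E|nra]. }
  set (f := fun h => exp (8 * INR n * h) * b +
    (exp (2 * INR n) - exp (2 * INR n / (1 + 2 * h))) * norm u).
  assert (Step : forall l, norm (minus w e) <= f (/ INR (S l))).
  { intros l'; set (l := S l').
    assert (HL : 0 < INR l) by (apply lt_0_INR; unfold l; lia).
    pose proof (euler_exp_distance dot X (2 * INR n) (l * n) u e LX
      ltac:(unfold l; nia) ltac:(lra) BX Ser) as D.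
    rewrite (iter_ext _ (euler_step T l)) in D.
    2: { intros v; unfold X, euler_step; rewrite mult_INR.
         vec_coefs; (apply injective_projections; [cbn [fst snd Cplus Cmult Copp RtoC]; try (field; lra); try ring|cbn [fst snd Cplus Cmult Copp RtoC]; ring]). }
    set (z := Nat.iter (l * n) (euler_step T l) u : H) in *.
    specialize (Bd l ltac:(unfold l; lia)); fold z in Bd.
    replace (minus w e) with (minus (minus w z) (minus e z) : H) by vec.
    assert (Tri : norm (minus (minus w z) (minus e z)) <=
                  norm (minus w z) + norm (minus e z)).
    { eapply Rle_trans; [exact (@norm_triangle C_AbsRing H _ _)|].
      right; f_equal; exact (@norm_opp C_AbsRing H _). }
    eapply Rle_trans; [exact Tri|]; unfold f.
    apply Rplus_le_compat; [exact Bd|].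
    eapply Rle_trans; [exact D|].
    apply Rmult_le_compat_r; [apply norm_ge_0|].
    pose proof (pow_1_plus_ge (2 * INR n / INR (l * n)) (l * n)
      ltac:(rewrite mult_INR; apply Rdiv_le_0_compat; nra)) as G.
    rewrite mult_INR in *.
    replace (INR l * INR n * (2 * INR n / (INR l * INR n) / (1 + 2 * INR n / (INR l * INR n))))
      with (2 * INR n / (1 + 2 * / INR l)) in G; [lra|].
    field; repeat split; try lra; nra. }
  assert (Lim : is_lim_seq (fun l => f (/ INR (S l))) b).
  { replace (Finite b) with (Finite (f 0)).
    2: { f_equal; unfold f; rewrite Rmult_0_r, exp_0.
         replace (2 * INR n / (1 + 2 * 0)) with (2 * INR n) by field; ring. }
    apply (is_lim_seq_continuous f).
    - apply derivable_continuous_pt, ex_derive_Reals_0; unfold f; auto_derive; lra.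
    - apply (is_lim_seq_incr_1 (fun l => / INR l)).
      replace (Finite 0) with (Rbar_inv p_infty) by reflexivity.
      apply is_lim_seq_inv; [apply is_lim_seq_INR|discriminate]. }
  exact (is_lim_seq_le _ _ (Finite (norm (minus w e))) (Finite b)
    Step (is_lim_seq_const _) Lim).
Qed.

(** * The operator norm *)

Lemma opnorm_le {H : NormedModule C_AbsRing} (S : H -> H) (b : R) :
  0 <= b -> (forall u, norm (S u) <= b * norm u) -> Rbar_le (opnorm S) b.
Proof.
  intros Hb E; apply (Lub_Rbar_correct _).
  intros r [u [Hu ->]]; simpl; pose proof (E u); nra.
Qed.

Lemma opnorm_nonexpansive {H : NormedModule C_AbsRing} (dot : inner_product H) (S : H -> H) :
  Clinear S -> Rbar_le (opnorm S) 1 -> nonexpansive S.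
Proof.
  intros LS E u.
  pose proof (norm_ge_0 u) as Hu.
  destruct (Req_dec (norm u) 0) as [Z|Z].
  - rewrite (norm_eq_zero _ Z), (Clinear_zero S LS); apply Rle_refl.
  - assert (HI : 0 < / norm u) by (apply Rinv_0_lt_compat; lra).
    set (v := scal (RtoC (/ norm u)) u : H).
    assert (Nv : norm v = 1) by (unfold v; rewrite (norm_scal_R dot) by lra; field; lra).
    assert (Q : Rbar_le (norm (S v)) 1).
    { eapply Rbar_le_trans; [|exact E].
      apply (proj1 (Lub_Rbar_correct _)); exists v; split; [lra|reflexivity]. }
    simpl in Q; unfold v in Q; rewrite (proj2 LS), (norm_scal_R dot) in Q by lra.
    apply (Rmult_le_reg_l (/ norm u)); [exact HI|]; rewrite Rinv_l by exact Z; exact Q.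
Qed.

(** * The constants *)

Lemma PI_upper : PI <= 3.26.
Proof.
  (* nine terms of the Leibniz series for PI / 4 *)
  pose proof (proj2 (PI_ineq 4)) as E.
  unfold sum_f_R0, tg_alt, PI_tg in E; simpl in E; lra.
Qed.

(** Since [2 cos b sin (b - a) = sin (2 b - a) - sin a]. *)
Lemma cos_sin_product_le (a b : R) : cos b * sin (b - a) <= (1 - sin a) / 2.
Proof.
  assert (E1 : sin (b + (b - a)) = sin b * cos (b - a) + cos b * sin (b - a)) by apply sin_plus.
  assert (E2 : sin a = sin b * cos (b - a) - cos b * sin (b - a)).
  { rewrite <- sin_minus; f_equal; ring. }
  pose proof (SIN_bound (b + (b - a))); lra.
Qed.

Lemma ln_sin_neg (b : R) : 0 < b < PI / 2 -> ln (sin b) < 0.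
Proof.
  intros Hb; rewrite <- ln_1; apply ln_increasing; [apply sin_gt_0; lra|].
  rewrite <- sin_PI2; apply sin_increasing_1; lra.
Qed.

Lemma K2_split (a b : R) :
  K2 a b = 2 / (cos b * sin (b - a)) * (1 / PI) +
    2 / (cos b * sin (b - a)) * (/ (exp 1 * - ln (sin b))).
Proof.
  unfold K2; replace (exp 1 * - ln (sin b)) with (- (exp 1 * ln (sin b))) by ring.
  rewrite Rinv_opp; unfold Rdiv; ring.
Qed.

Lemma K2_prefactor (a b : R) : 0 <= a < PI / 2 -> a < b < PI / 2 ->
  4 / (1 - sin a) <= 2 / (cos b * sin (b - a)) /\ 0 < cos b * sin (b - a) /\ sin a < 1.
Proof.
  intros Ha Hb.
  assert (0 < cos b * sin (b - a)).
  { apply Rmult_lt_0_compat; [apply cos_gt_0|apply sin_gt_0]; lra. }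
  assert (sin a < 1) by (rewrite <- sin_PI2; apply sin_increasing_1; lra).
  repeat split; auto.
  pose proof (cos_sin_product_le a b).
  replace (4 / (1 - sin a)) with (2 * / ((1 - sin a) / 2)) by (field; lra).
  unfold Rdiv at 2; apply Rmult_le_compat_l; [lra|]; now apply Rinv_le_contravar.
Qed.

(** Sharp enough for small [a].  The summand of [K2 a b] with the logarithm is
    bounded by [sin (b - a) <= t] and [- t ln t <= 1 / e] at [t = sin b]. *)
Lemma K2_ge_cos (a b : R) : 0 <= a < PI / 2 -> a < b < PI / 2 ->
  4 / PI / (1 - sin a) + 2 / cos a <= K2 a b.
Proof.
  intros Ha Hb; destruct (K2_prefactor a b Ha Hb) as (E1 & E2 & E3).
  rewrite K2_split; apply Rplus_le_compat.
  - pose proof PI_RGT_0.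
    replace (4 / PI / (1 - sin a)) with (4 / (1 - sin a) * (1 / PI)) by (field; lra).
    apply Rmult_le_compat_r; [|exact E1]; apply Rdiv_le_0_compat; lra.
  - pose proof (ln_sin_neg b ltac:(lra)) as Hl.
    pose proof (exp_pos 1) as He.
    assert (Ht : 0 < sin b) by (apply sin_gt_0; lra).
    assert (Hc : 0 < cos b) by (apply cos_gt_0; lra).
    assert (Hcc : cos b <= cos a) by (left; apply cos_decreasing_1; lra).
    assert (HS : sin (b - a) <= sin b) by (apply sin_incr_1; lra).
    assert (HS0 : 0 < sin (b - a)) by (apply sin_gt_0; lra).
    assert (Hx : sin b * (exp 1 * - ln (sin b)) <= 1).
    { pose proof (exp_ineq1_le (- ln (sin b) - 1)) as Q.
      unfold Rminus in Q; rewrite exp_plus, exp_Ropp, exp_ln, exp_Ropp in Q by lra.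
      apply Rle_trans with (sin b * exp 1 * (/ sin b * / exp 1)); [|right; field; lra].
      rewrite <- Rmult_assoc; apply Rmult_le_compat_l; [nra|lra]. }
    unfold Rdiv; rewrite Rmult_assoc, <- Rinv_mult.
    apply Rmult_le_compat_l; [lra|]; apply Rinv_le_contravar.
    + apply Rmult_lt_0_compat; [exact E2|]; nra.
    + assert (sin (b - a) * (exp 1 * - ln (sin b)) <= 1) by nra.
      nra.
Qed.

(** Sharp enough for [a] near [PI / 2].  The summand of [K2 a b] with the
    logarithm is bounded by [- ln t <= (1 - t) / t] at [t = sin b >= sin a]. *)
Lemma K2_ge_sin (a b : R) : 0 <= a < PI / 2 -> a < b < PI / 2 -> 0 < sin a ->
  4 / PI / (1 - sin a) + 4 * sin a / (exp 1 * (1 - sin a) ^ 2) <= K2 a b.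
Proof.
  intros Ha Hb Hs; destruct (K2_prefactor a b Ha Hb) as (E1 & E2 & E3).
  rewrite K2_split; apply Rplus_le_compat.
  - pose proof PI_RGT_0.
    replace (4 / PI / (1 - sin a)) with (4 / (1 - sin a) * (1 / PI)) by (field; lra).
    apply Rmult_le_compat_r; [|exact E1]; apply Rdiv_le_0_compat; lra.
  - pose proof (ln_sin_neg b ltac:(lra)) as Hl.
    pose proof (exp_pos 1) as He.
    assert (Ht : sin a <= sin b) by (apply sin_incr_1; lra).
    assert (Hx : - ln (sin b) <= (1 - sin a) / sin a).
    { pose proof (exp_ineq1_le (- ln (sin b))) as Q.
      rewrite exp_Ropp, exp_ln in Q by lra.
      assert (/ sin b <= / sin a) by (apply Rinv_le_contravar; lra).
      replace ((1 - sin a) / sin a) with (/ sin a - 1) by (field; lra); lra. }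
    replace (4 * sin a / (exp 1 * (1 - sin a) ^ 2)) with
      (4 / (1 - sin a) * / (exp 1 * ((1 - sin a) / sin a))) by (field; lra).
    apply Rmult_le_compat; [apply Rdiv_le_0_compat; lra| |exact E1|].
    + left; apply Rinv_0_lt_compat, Rmult_lt_0_compat; [exact He|].
      apply Rdiv_lt_0_compat; lra.
    + apply Rinv_le_contravar; [nra|]; apply Rmult_le_compat_l; lra.
Qed.

(** The left-hand side is the constant of [power_euler_distance] once
    [3 + ln n] has been bounded by [(11 / 3) n^(1/6)] and [n^(1/6)] is at least 2.
    For [sin a <= 1 / 2] it is dominated through [K2_ge_cos], otherwise
    through [K2_ge_sin]. *)
Lemma K2_constant (a b : R) : 0 <= a < PI / 2 -> a < b < PI / 2 ->
  (1 + 11 / 3 / cos a) / sqrt ((1 - sin a) / 2) <= 2 * K2 a b + 2.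
Proof.
  intros Ha Hb.
  assert (Hs0 : 0 <= sin a) by (apply sin_ge_0; lra).
  assert (Hs1 : sin a < 1) by (rewrite <- sin_PI2; apply sin_increasing_1; lra).
  assert (Hc : 0 < cos a) by (apply cos_gt_0; lra).
  pose proof (sin2_cos2 a) as T; unfold Rsqr in T.
  set (s := sin a) in *.
  set (d := sqrt ((1 - s) / 2)).
  assert (Hd : 0 < d) by (apply sqrt_lt_R0; lra).
  assert (Ed : d ^ 2 = (1 - s) / 2) by (apply pow2_sqrt; lra).
  pose proof PI_upper; pose proof PI_RGT_0.
  assert (HP : 1.22 <= 4 / PI).
  { apply (Rmult_le_reg_r PI); [assumption|]; unfold Rdiv; rewrite Rmult_assoc, Rinv_l; lra. }
  set (c := cos a) in *.
  set (r := d / c).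
  assert (Hr : 0 < r) by (apply Rdiv_lt_0_compat; lra).
  assert (Er : r ^ 2 * (2 * (1 + s)) = 1).
  { replace (r ^ 2 * (2 * (1 + s))) with (d ^ 2 * 2 * (1 + s) / c ^ 2) by (unfold r; field; lra).
    rewrite Ed; replace (c ^ 2) with ((1 - s) * (1 + s)) by nra; field; lra. }
  (* in the variables d and r = d / c the inequality is polynomial *)
  assert (Goal : d + 11 / 3 * r <= d ^ 2 * (2 * K2 a b + 2)).
  { destruct (Rle_dec s (1 / 2)) as [Hs|Hs].
    - pose proof (K2_ge_cos a b Ha Hb) as B; fold s c in B.
      assert (B2 : 4 / PI + 4 * d * r <= d ^ 2 * (2 * K2 a b)).
      { apply Rle_trans with (d ^ 2 * (2 * (4 / PI / (1 - s) + 2 / c))).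
        - right; replace (1 - s) with (2 * d ^ 2) by lra; unfold r; field; lra.
        - apply Rmult_le_compat_l; nra. }
      assert (r <= 0.70711) by nra.
      assert (1 / 2 <= d) by nra.
      assert (d <= 0.70711) by nra.
      nra.
    - pose proof (K2_ge_sin a b Ha Hb ltac:(fold s; lra)) as B; fold s in B.
      assert (B2 : 4 / PI + 4 / 3 <= d ^ 2 * (2 * K2 a b)).
      { apply Rle_trans with (d ^ 2 * (2 * (4 / PI / (1 - s) + 4 * s / (exp 1 * (1 - s) ^ 2)))).
        - pose proof exp_le_3; pose proof (exp_pos 1).
          replace (d ^ 2 * (2 * (4 / PI / (1 - s) + 4 * s / (exp 1 * (1 - s) ^ 2)))) with
            (4 / PI + 2 * s / (exp 1 * d ^ 2)).
          2: { replace (1 - s) with (2 * d ^ 2) by lra; field; lra. }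
          apply Rplus_le_compat_l.
          assert (0 < exp 1 * d ^ 2) by (apply Rmult_lt_0_compat; nra).
          apply (Rmult_le_reg_r (exp 1 * d ^ 2)); [assumption|].
          unfold Rdiv at 2; rewrite Rmult_assoc, Rinv_l by lra; nra.
        - apply Rmult_le_compat_l; nra. }
      assert (r <= 0.5774) by nra.
      nra. }
  apply (Rmult_le_reg_l (d ^ 2)); [nra|].
  eapply Rle_trans; [|exact Goal].
  right; unfold r; field; lra.
Qed.

(** * The minimum over the larger angle *)

Lemma K2_continuous (a b : R) : 0 <= a < PI / 2 -> a < b < PI / 2 ->
  continuity_pt (K2 a) b.
Proof.
  intros Ha Hb.
  destruct (K2_prefactor a b Ha Hb) as (_ & E2 & _).
  pose proof (ln_sin_neg b ltac:(lra)); pose proof (exp_pos 1).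
  apply derivable_continuous_pt, ex_derive_Reals_0; unfold K2; auto_derive.
  replace (b + - a) with (b - a) by ring.
  repeat split; try lra.
  - apply sin_gt_0; lra.
  - nra.
Qed.

(** [K2 a] blows up at both ends of the interval: drop the logarithm, bound
    one of the factors [cos b] and [sin (b - a)] by 1 and the other by the
    distance to the end where it vanishes. *)
Lemma K2_ge_inv (a b : R) : 0 <= a < PI / 2 -> a < b < PI / 2 ->
  2 / PI / (b - a) <= K2 a b /\ 2 / PI / (PI / 2 - b) <= K2 a b.
Proof.
  intros Ha Hb.
  destruct (K2_prefactor a b Ha Hb) as (_ & E2 & _).
  pose proof (ln_sin_neg b ltac:(lra)) as Hl; pose proof (exp_pos 1); pose proof PI_RGT_0.
  assert (0 < sin (b - a)) by (apply sin_gt_0; lra).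
  assert (0 < cos b) by (apply cos_gt_0; lra).
  assert (Hs : sin (b - a) < b - a) by (apply sin_lt_x; lra).
  assert (Hc : cos b < PI / 2 - b) by (rewrite cos_sin, <- sin_PI_x;
     replace (PI - (PI / 2 + b)) with (PI / 2 - b) by lra; apply sin_lt_x; lra).
  pose proof (SIN_bound (b - a)); pose proof (COS_bound b).
  assert (L : 2 / PI * / (cos b * sin (b - a)) <= K2 a b).
  { rewrite K2_split.
    assert (0 <= 2 / (cos b * sin (b - a)) * / (exp 1 * - ln (sin b))).
    { apply Rmult_le_pos; [apply Rdiv_le_0_compat; lra|].
      left; apply Rinv_0_lt_compat; nra. }
    replace (2 / PI * / (cos b * sin (b - a))) with (2 / (cos b * sin (b - a)) * (1 / PI))
      by (field; lra); lra. }
  assert (0 < 2 / PI) by (apply Rdiv_lt_0_compat; lra).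
  split; (eapply Rle_trans; [|exact L]; unfold Rdiv at 1;
    apply Rmult_le_compat_l; [lra|]; apply Rinv_le_contravar; nra).
Qed.

Lemma K2_min_exists (a : R) : 0 <= a < PI / 2 ->
  exists b, a < b < PI / 2 /\ forall x, a < x < PI / 2 -> K2 a b <= K2 a x.
Proof.
  intros Ha.
  set (m := (a + PI / 2) / 2).
  assert (Hm : a < m < PI / 2) by (unfold m; lra).
  pose proof PI_RGT_0.
  assert (H2 : 0 < 2 / PI) by (apply Rdiv_lt_0_compat; lra).
  pose proof (K2_ge_inv a m Ha Hm) as [L1 L2].
  assert (HK : 0 < K2 a m).
  { eapply Rlt_le_trans; [|exact L1]; apply Rdiv_lt_0_compat; lra. }
  (* closer than d to an end, K2 a exceeds its value at the midpoint *)
  set (d := 2 / PI / K2 a m).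
  assert (Hd : 0 < d) by (apply Rdiv_lt_0_compat; lra).
  assert (Far : forall y, 0 < y -> 2 / PI / y <= K2 a m -> d <= y).
  { intros y Hy E; unfold d.
    apply (Rmult_le_reg_r (K2 a m)); [exact HK|].
    replace (2 / PI / K2 a m * K2 a m) with (2 / PI / y * y) by (field; lra).
    rewrite (Rmult_comm y); apply Rmult_le_compat_r; lra. }
  pose proof (Far (m - a) ltac:(lra) L1) as F1.
  pose proof (Far (PI / 2 - m) ltac:(lra) L2) as F2.
  destruct (continuity_ab_min (K2 a) (a + d) (PI / 2 - d)) as [b [Hmin Hb]].
  - lra.
  - intros x Hx; apply K2_continuous; lra.
  - exists b; split; [lra|]; intros x Hx.
    pose proof (K2_ge_inv a x Ha Hx) as [G1 G2].
    pose proof (Hmin m ltac:(lra)) as Hbm.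
    destruct (Rle_dec (K2 a m) (K2 a x)) as [Q|Q]; [lra|].
    apply Hmin; split.
    + pose proof (Far (x - a) ltac:(lra) ltac:(lra)); lra.
    + pose proof (Far (PI / 2 - x) ltac:(lra) ltac:(lra)); lra.
Qed.

(** * The rate of convergence *)

Lemma exp_pow (x : R) (n : nat) : exp (INR n * x) = exp x ^ n.
Proof.
  induction n as [|n IH]; [simpl; rewrite Rmult_0_l; apply exp_0|].
  rewrite S_INR, Rmult_plus_distr_r, exp_plus, IH, Rmult_1_l; simpl; ring.
Qed.

(** The tangent line of [exp] at [1 / 2], evaluated at [ln x / 6]: the least
    possible constant is [6 exp (- 1 / 2)], just below [11 / 3]. *)
Lemma ln_le_sixth_root (x : R) : 0 < x ->
  3 + ln x <= 11 / 3 * exp (ln x / 6).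
Proof.
  intros Hx.
  assert (Hh : 18 / 11 <= exp (1 / 2)).
  { apply Rle_trans with ((1 + 1 / 64) ^ 32); [lra|].
    replace (exp (1 / 2)) with (exp (1 / 64) ^ 32).
    - apply pow_incr; split; [lra|apply exp_ineq1_le].
    - rewrite <- exp_pow; f_equal; simpl; lra. }
  pose proof (exp_ineq1_le (ln x / 6 - 1 / 2)) as E.
  replace (exp (ln x / 6)) with (exp (1 / 2) * exp (ln x / 6 - 1 / 2)).
  2: { rewrite <- exp_plus; f_equal; ring. }
  pose proof (exp_pos (ln x / 6 - 1 / 2)); nra.
Qed.

(** With [y = n^(1/6)]: for [y <= 2] the trivial bound 2 on the operators is
    enough, because [L >= 8]; for [y >= 2] the claim is [K2_constant]. *)
Lemma rate_le (a b : R) (n : nat) : 0 <= a < PI / 2 -> a < b < PI / 2 -> (1 <= n)%nat ->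
  let L := 2 * K2 a b + 2 in
  2 <= L / Rpower (INR n) (1 / 3) \/
  (2 + (3 + ln (INR n)) / cos a) / sqrt ((1 - sin a) / 2 * INR n) <=
    L / Rpower (INR n) (1 / 3).
Proof.
  intros Ha Hb Hn L.
  assert (HN : 1 <= INR n) by (apply (le_INR 1); lia).
  assert (Hs1 : sin a < 1) by (rewrite <- sin_PI2; apply sin_increasing_1; lra).
  assert (Hc : 0 < cos a) by (apply cos_gt_0; lra).
  pose proof (COS_bound a) as [_ Hc1].
  assert (Hs0 : 0 <= sin a) by (apply sin_ge_0; lra).
  set (y := exp (ln (INR n) / 6)).
  assert (Hy : 0 < y) by apply exp_pos.
  assert (E2 : Rpower (INR n) (1 / 3) = y ^ 2).
  { unfold Rpower, y; rewrite <- exp_pow; f_equal; simpl; field. }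
  assert (E6 : INR n = (y ^ 3) ^ 2).
  { rewrite <- pow_mult; unfold y; rewrite <- exp_pow.
    rewrite <- (exp_ln (INR n)) at 1 by lra; f_equal; simpl; field. }
  rewrite E2.
  pose proof (K2_constant a b Ha Hb) as KC; fold L in KC.
  set (d := sqrt ((1 - sin a) / 2)) in *.
  assert (Hd : 0 < d) by (apply sqrt_lt_R0; lra).
  destruct (Rle_dec y 2) as [Y|Y].
  - left.
    assert (8 <= L).
    { pose proof (K2_ge_cos a b Ha Hb) as B; pose proof PI_RGT_0; pose proof PI_upper.
      assert (1.22 <= 4 / PI).
      { apply (Rmult_le_reg_r PI); [assumption|]; unfold Rdiv; rewrite Rmult_assoc, Rinv_l; lra. }
      assert (4 / PI <= 4 / PI / (1 - sin a)).
      { rewrite <- (Rmult_1_r (4 / PI)) at 1; unfold Rdiv at 2.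
        apply Rmult_le_compat_l; [lra|]; rewrite <- Rinv_1; apply Rinv_le_contravar; lra. }
      assert (2 <= 2 / cos a).
      { rewrite <- (Rmult_1_r 2) at 1; unfold Rdiv.
        apply Rmult_le_compat_l; [lra|]; rewrite <- Rinv_1; apply Rinv_le_contravar; lra. }
      unfold L; lra. }
    apply (Rmult_le_reg_r (y ^ 2)); [nra|]; unfold Rdiv; rewrite Rmult_assoc, Rinv_l; nra.
  - right.
    rewrite sqrt_mult by lra; fold d.
    rewrite E6 at 2; rewrite sqrt_pow2 by (apply pow_le; lra).
    pose proof (ln_le_sixth_root (INR n) ltac:(lra)) as Hln; fold y in Hln.
    apply Rle_trans with ((1 + 11 / 3 / cos a) / d / y ^ 2).
    + replace ((1 + 11 / 3 / cos a) / d / y ^ 2) with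
        ((y + 11 / 3 * y / cos a) / (d * y ^ 3)) by (field; lra).
      unfold Rdiv at 1 4; apply Rmult_le_compat_r.
      * left; apply Rinv_0_lt_compat, Rmult_lt_0_compat; [exact Hd|now apply pow_lt].
      * apply Rplus_le_compat; [lra|]; apply Rmult_le_compat_r; [|exact Hln].
        left; now apply Rinv_0_lt_compat.
    + unfold Rdiv at 1 5; apply Rmult_le_compat_r; [|exact KC].
      left; apply Rinv_0_lt_compat; nra.
Qed.

(** The first bound is the triangle inequality for two contractions. *)
Lemma power_exp_distance {H : NormedModule C_AbsRing} (dot : inner_product H)
    (alpha : R) (T : H -> H) (n : nat) (u e : H) :
  0 <= alpha < PI / 2 -> Clinear T -> nonexpansive T ->
  (forall z, num_range dot T z -> D_set alpha z) -> (1 <= n)%nat ->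
  is_series (exp_term (fun v => scal (RtoC (INR n)) (minus (T v) v)) u) e ->
  norm (minus (Nat.iter n T u) e) <= 2 * norm u /\
  norm (minus (Nat.iter n T u) e) <=
    (2 + (3 + ln (INR n)) / cos alpha) / sqrt ((1 - sin alpha) / 2 * INR n) * norm u.
Proof.
  intros Ha LT CT W Hn Ser.
  assert (Hs1 : sin alpha < 1) by (rewrite <- sin_PI2; apply sin_increasing_1; lra).
  pose proof (norm_ge_0 u) as Nu.
  split; apply (euler_limit dot T n _ u _ e LT CT Hn Ser); intros l Hl.
  - apply Rle_trans with (2 * norm u).
    + eapply Rle_trans; [exact (@norm_triangle C_AbsRing H _ _)|].
      pose proof (@norm_opp C_AbsRing H (Nat.iter (l * n) (euler_step T l) u)) as E.
      pose proof (nonexpansive_iter _ n CT u).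
      pose proof (nonexpansive_iter _ (l * n) (euler_step_nonexpansive dot T l CT Hl) u).
      apply Rle_trans with (norm (Nat.iter n T u) + norm (Nat.iter (l * n) (euler_step T l) u));
        [right; f_equal; exact E|lra].
    + rewrite <- (Rmult_1_l (2 * norm u)) at 1; apply Rmult_le_compat_r; [lra|].
      rewrite <- exp_0; apply exp_monotone.
      apply Rdiv_le_0_compat; [pose proof (pos_INR n); lra|apply lt_0_INR; lia].
  - rewrite <- Rmult_assoc; destruct n as [|p]; [lia|].
    apply (power_euler_distance dot alpha ((1 - sin alpha) / 2)); auto; [lra| |].
    + intros v; now apply quasi_sectorial_sector.
    + intros t v; now apply quasi_sectorial_disc.
Qed.

Theorem theorem4p1 (H : CompleteNormedModule C_AbsRing) (dot : inner_product H)
    (alpha : R) (T : H -> H) :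
  0 <= alpha < PI / 2 ->
  quasi_sectorial dot alpha T ->
  exists K : R, is_K alpha K /\
    let L := 2 * K + 2 in
    forall n : nat, (1 <= n)%nat ->
      Rbar_le
        (opnorm (fun u : H =>
           minus (op_pow T n u)
             (op_exp (fun v : H => scal (RtoC (INR n)) (minus (T v) v)) u)))
        (L / Rpower (INR n) (1 / 3)).
Proof.
  intros Ha [[TL TN] W].
  assert (LT : @Clinear H T) by (split; [apply (linear_plus T TL)|apply (linear_scal T TL)]).
  assert (CT : @nonexpansive H T) by now apply (opnorm_nonexpansive dot).
  destruct (K2_min_exists alpha Ha) as [b [Hb Hmin]].
  exists (K2 alpha b); split.
  { split; [exists b; auto|]; intros x [b' [Hb' ->]]; now apply Hmin. }
  intros L n Hn.
  pose proof (rate_le alpha b n Ha Hb Hn) as Rate; fold L in Rate.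
  assert (LP : 0 <= L / Rpower (INR n) (1 / 3)).
  { apply Rdiv_le_0_compat; [|apply exp_pos].
    pose proof (K2_ge_inv alpha b Ha Hb) as [Q _].
    assert (0 < 2 / PI / (b - alpha)).
    { pose proof PI_RGT_0; repeat apply Rdiv_lt_0_compat; lra. }
    unfold L; lra. }
  apply (@opnorm_le H); [exact LP|]; intros u.
  assert (BX : forall v : H, norm (scal (RtoC (INR n)) (minus (T v) v)) <=
    INR n * 2 * norm v).
  { intros v; eapply Rle_trans; [exact (@norm_scal_Cmod H _ _)|].
    pose proof (pos_INR n); rewrite Cmod_R, Rabs_right by lra.
    rewrite Rmult_assoc; apply Rmult_le_compat_l; [lra|].
    eapply Rle_trans; [exact (@norm_triangle C_AbsRing H _ _)|].
    pose proof (@norm_opp C_AbsRing H v) as E; pose proof (CT v).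
    apply Rle_trans with (norm (T v) + norm v); [right; f_equal; exact E|].
    apply Rle_trans with (norm v + norm v); [apply Rplus_le_compat_r; assumption|lra]. }
  pose proof (op_exp_is_series _ (INR n * 2) u ltac:(pose proof (pos_INR n); lra) BX) as Ser.
  destruct (power_exp_distance dot alpha T n u _ Ha LT CT W Hn Ser) as [B1 B2].
  pose proof (@norm_ge_0 C_AbsRing H u) as Nu.
  destruct Rate as [Q|Q]; [eapply Rle_trans; [exact B1|]|eapply Rle_trans; [exact B2|]];
    now apply Rmult_le_compat_r.
Qed.
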